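(* Let $X$ be a path connected finite CW complex, let $C=C(X)$, let $n\ge 1$ be an integer and let $A=C([0,1],M_n)$. For any $\epsilon>0$ and any finite subset $\mathcal F\subset C$, there exist a finite subset $\mathcal G\subset C$ and $\delta>0$ satisfying the following: Let $\phi,\psi: C\to A$ be two unital homomorphisms such that $$|\tau\circ\phi(g)-\tau\circ\psi(g)|<\delta\quad\text{for all } g\in\mathcal G\text{ and all }\tau\in T(A).$$ Then there exists a unitary $U\in A$ such that $$\|\mathrm{ad}\,U\circ\phi(f)-\psi(f)\|<\epsilon\quad\text{for all } f\in\mathcal F.$$ Moreover, if, in addition, $\phi(f)(0)=\psi(f)(0)$ for all $f\in C(X)$, then one may choose $U$ with $U(0)=1_{M_n}$; and if, in addition, $\phi(f)(0)=\psi(f)(0)$ and $\phi(f)(1)=\psi(f)(1)$ for all $f\in C(X)$, then one may choose $U$ with $U(0)=U(1)=1_{M_n}$.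
   Context: $M_n$ is the algebra of $n\times n$ complex matrices; homomorphisms are $*$-homomorphisms; $T(A)$ is the set of tracial states of $A$; for a unitary $U$, $\mathrm{ad}\,U(a)=U^*aU$. *)

(* Defs.v *)
From HB Require Import structures.
From mathcomp Require Import all_boot all_order all_algebra.
From mathcomp Require Import complex.
From mathcomp Require Import all_classical all_reals all_analysis homotopy.

Set Implicit Arguments.
Unset Strict Implicit.
Unset Printing Implicit Defensive.

Import Order.TTheory GRing.Theory Num.Theory numFieldNormedType.Exports.

Local Open Scope classical_set_scope.
Local Open Scope sesquilinear_scope.
Local Open Scope ring_scope.

(* [R[i]] carries the topology of its modulus; the library's instance is only
   keyed on the regular module [R[i]^o]. Matrices over [R[i]] then get the
   entrywise topology. *)
HB.instance Definition _ (R : realType) :=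
  PseudoPointedMetric.copy R[i] (R[i]^o).

Section Continuity.
Context {R : realType} {T : topologicalType}.
Implicit Types (f g : T -> R[i]).

Lemma continuousC_add f g : continuous f -> continuous g ->
  continuous (fun x => f x + g x).
Proof.
move=> cf cg x; exact: (@cvgD _ (R[i]^o) T (nbhs x) _ f g _ _ (cf x) (cg x)).
Qed.

Lemma continuousC_mul f g : continuous f -> continuous g ->
  continuous (fun x => f x * g x).
Proof.
move=> cf cg x; exact: (@cvgM R[i] T (nbhs x) _ f g _ _ (cf x) (cg x)).
Qed.

Lemma continuousC_opp f : continuous f -> continuous (fun x => - f x).
Proof.
move=> cf x; exact: (@cvgN _ (R[i]^o) T (nbhs x) _ f _ (cf x)).
Qed.

Lemma continuousC_conj f : continuous f -> continuous (fun x => (f x)^*).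
Proof.
move=> cf x; apply/(@cvgrPdist_lt _ (R[i]^o) T (nbhs x) _) => e e0.
have /(@cvgrPdist_lt _ (R[i]^o) T (nbhs x) _) /(_ _ e0) := cf x.
by apply: filterS => y /=; rewrite -rmorphB norm_conjC.
Qed.

Lemma continuousC_sum (I : finType) (f : I -> T -> R[i]) :
  (forall i, continuous (f i)) -> continuous (fun x => \sum_i f i x).
Proof.
move=> cf; elim: (index_enum I) => [|i r IH].
  by under eq_fun do rewrite big_nil; exact: cst_continuous.
by under eq_fun do rewrite big_cons; exact: continuousC_add (cf i) IH.
Qed.

Lemma continuous_mxP m n (f : T -> 'M[R[i]]_(m, n)) :
  continuous f <-> forall i j, continuous (fun x => f x i j).
Proof.
split=> [cf i j x A nA | cf x A [P nP sPA]].
  apply: (cf x [set M | A (M i j)]).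
  exists (fun i' j' => if (i' == i) && (j' == j) then A else setT).
    by move=> i' j'; case: ifPn => [/andP[/eqP-> /eqP->] //|_]; exact: filterT.
  by move=> M /(_ i j) /=; rewrite !eqxx.
have : \forall y \near x, forall i j, P i j (f y i j).
  by apply: filter_forall => i; apply: filter_forall => j; exact: cf (nP i j).
by apply: filterS => y Py; apply: sPA.
Qed.

End Continuity.

Section FunctionAlgebra.
Context {R : realType} {X : topologicalType}.

Definition cfun := continuousType X R[i].
HB.instance Definition _ := Choice.on cfun.

Implicit Types f g h : cfun.

Definition cfun_zero : cfun := mkcts (@cst_continuous X R[i] 0).
Definition cfun_one : cfun := mkcts (@cst_continuous X R[i] 1).
Definition cfun_add f g : cfun :=
  mkcts (continuousC_add (@cts_fun _ _ f) (@cts_fun _ _ g)).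
Definition cfun_opp f : cfun := mkcts (continuousC_opp (@cts_fun _ _ f)).
Definition cfun_mul f g : cfun :=
  mkcts (continuousC_mul (@cts_fun _ _ f) (@cts_fun _ _ g)).
Definition cfun_scale (k : R[i]) f : cfun :=
  mkcts (continuousC_mul (@cst_continuous X R[i] k) (@cts_fun _ _ f)).
Definition cfun_star f : cfun := mkcts (continuousC_conj (@cts_fun _ _ f)).

Lemma cfun_addA : associative cfun_add.
Proof. by move=> f g h; apply/continuousEP => x; exact: addrA. Qed.
Lemma cfun_addC : commutative cfun_add.
Proof. by move=> f g; apply/continuousEP => x; exact: addrC. Qed.
Lemma cfun_add0 : left_id cfun_zero cfun_add.
Proof. by move=> f; apply/continuousEP => x; exact: add0r. Qed.
Lemma cfun_addN : left_inverse cfun_zero cfun_opp cfun_add.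
Proof. by move=> f; apply/continuousEP => x; exact: addNr. Qed.

HB.instance Definition _ :=
  GRing.isZmodule.Build cfun cfun_addA cfun_addC cfun_add0 cfun_addN.

Lemma cfun_mulA : associative cfun_mul.
Proof. by move=> f g h; apply/continuousEP => x; exact: mulrA. Qed.
Lemma cfun_mulC : commutative cfun_mul.
Proof. by move=> f g; apply/continuousEP => x; exact: mulrC. Qed.
Lemma cfun_mul1 : left_id cfun_one cfun_mul.
Proof. by move=> f; apply/continuousEP => x; exact: mul1r. Qed.
Lemma cfun_mulDl : left_distributive cfun_mul +%R.
Proof. by move=> f g h; apply/continuousEP => x; exact: mulrDl. Qed.

HB.instance Definition _ := GRing.Zmodule_isComPzRing.Build cfun
  cfun_mulA cfun_mulC cfun_mul1 cfun_mulDl.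

Lemma cfun_scaleA a b f : cfun_scale a (cfun_scale b f) = cfun_scale (a * b) f.
Proof. by apply/continuousEP => x; exact: mulrA. Qed.
Lemma cfun_scale1 : left_id 1 cfun_scale.
Proof. by move=> f; apply/continuousEP => x; exact: mul1r. Qed.
Lemma cfun_scaleDr : right_distributive cfun_scale +%R.
Proof. by move=> k f g; apply/continuousEP => x; exact: mulrDr. Qed.
Lemma cfun_scaleDl f : {morph cfun_scale^~ f : a b / a + b}.
Proof. by move=> a b; apply/continuousEP => x; exact: mulrDl. Qed.

HB.instance Definition _ := GRing.Zmodule_isLmodule.Build R[i] cfun
  cfun_scaleA cfun_scale1 cfun_scaleDr cfun_scaleDl.

End FunctionAlgebra.
Arguments cfun : clear implicits.

Section MatrixFunctionAlgebra.
Context {R : realType} {T : topologicalType} {n : nat}.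

Definition cmxfun := continuousType T 'M[R[i]]_n.
HB.instance Definition _ := Choice.on cmxfun.

Implicit Types a b c : cmxfun.

Lemma cmxfun_entry a i j : continuous (fun t => a t i j).
Proof. exact: ((continuous_mxP a).1 (@cts_fun _ _ a)). Qed.

Lemma cmxfun_add_cts a b : continuous (fun t => a t + b t).
Proof.
apply/continuous_mxP => i j; under eq_fun do rewrite mxE.
by apply: continuousC_add; exact: cmxfun_entry.
Qed.

Lemma cmxfun_opp_cts a : continuous (fun t => - a t).
Proof.
apply/continuous_mxP => i j; under eq_fun do rewrite mxE.
by apply: continuousC_opp; exact: cmxfun_entry.
Qed.

Lemma cmxfun_mul_cts a b : continuous (fun t => a t *m b t).
Proof.
apply/continuous_mxP => i j; under eq_fun do rewrite mxE.
by apply: continuousC_sum => k; apply: continuousC_mul; exact: cmxfun_entry.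
Qed.

Lemma cmxfun_scale_cts (k : R[i]) a : continuous (fun t => k *: a t).
Proof.
apply/continuous_mxP => i j; under eq_fun do rewrite mxE.
by apply: continuousC_mul; [exact: cst_continuous | exact: cmxfun_entry].
Qed.

Lemma cmxfun_star_cts a : continuous (fun t => (a t)^t*).
Proof.
apply/continuous_mxP => i j; under eq_fun do rewrite !mxE.
by apply: continuousC_conj; exact: cmxfun_entry.
Qed.

Arguments cmxfun_add_cts : clear implicits.
Arguments cmxfun_opp_cts : clear implicits.
Arguments cmxfun_mul_cts : clear implicits.
Arguments cmxfun_scale_cts : clear implicits.
Arguments cmxfun_star_cts : clear implicits.

Definition cmxfun_zero : cmxfun := mkcts (@cst_continuous T 'M[R[i]]_n 0).
Definition cmxfun_one : cmxfun := mkcts (@cst_continuous T 'M[R[i]]_n 1%:M).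
Definition cmxfun_add a b : cmxfun := mkcts (cmxfun_add_cts a b).
Definition cmxfun_opp a : cmxfun := mkcts (cmxfun_opp_cts a).
Definition cmxfun_mul a b : cmxfun := mkcts (cmxfun_mul_cts a b).
Definition cmxfun_scale k a : cmxfun := mkcts (cmxfun_scale_cts k a).
Definition cmxfun_star a : cmxfun := mkcts (cmxfun_star_cts a).

Lemma cmxfun_addA : associative cmxfun_add.
Proof. by move=> a b c; apply/continuousEP => t; exact: addrA. Qed.
Lemma cmxfun_addC : commutative cmxfun_add.
Proof. by move=> a b; apply/continuousEP => t; exact: addrC. Qed.
Lemma cmxfun_add0 : left_id cmxfun_zero cmxfun_add.
Proof. by move=> a; apply/continuousEP => t; exact: add0r. Qed.
Lemma cmxfun_addN : left_inverse cmxfun_zero cmxfun_opp cmxfun_add.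
Proof. by move=> a; apply/continuousEP => t; exact: addNr. Qed.

HB.instance Definition _ :=
  GRing.isZmodule.Build cmxfun cmxfun_addA cmxfun_addC cmxfun_add0 cmxfun_addN.

Lemma cmxfun_mulA : associative cmxfun_mul.
Proof. by move=> a b c; apply/continuousEP => t; exact: mulmxA. Qed.
Lemma cmxfun_mul1 : left_id cmxfun_one cmxfun_mul.
Proof. by move=> a; apply/continuousEP => t; exact: mul1mx. Qed.
Lemma cmxfun_mulr1 : right_id cmxfun_one cmxfun_mul.
Proof. by move=> a; apply/continuousEP => t; exact: mulmx1. Qed.
Lemma cmxfun_mulDl : left_distributive cmxfun_mul +%R.
Proof. by move=> a b c; apply/continuousEP => t; exact: mulmxDl. Qed.
Lemma cmxfun_mulDr : right_distributive cmxfun_mul +%R.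
Proof. by move=> a b c; apply/continuousEP => t; exact: mulmxDr. Qed.

HB.instance Definition _ := GRing.Zmodule_isPzRing.Build cmxfun
  cmxfun_mulA cmxfun_mul1 cmxfun_mulr1 cmxfun_mulDl cmxfun_mulDr.

Lemma cmxfun_scaleA k l a :
  cmxfun_scale k (cmxfun_scale l a) = cmxfun_scale (k * l) a.
Proof. by apply/continuousEP => t; exact: scalerA. Qed.
Lemma cmxfun_scale1 : left_id 1 cmxfun_scale.
Proof. by move=> a; apply/continuousEP => t; exact: scale1r. Qed.
Lemma cmxfun_scaleDr : right_distributive cmxfun_scale +%R.
Proof. by move=> k a b; apply/continuousEP => t; exact: scalerDr. Qed.
Lemma cmxfun_scaleDl a : {morph cmxfun_scale^~ a : k l / k + l}.
Proof. by move=> k l; apply/continuousEP => t; exact: scalerDl. Qed.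

HB.instance Definition _ := GRing.Zmodule_isLmodule.Build R[i] cmxfun
  cmxfun_scaleA cmxfun_scale1 cmxfun_scaleDr cmxfun_scaleDl.

Definition unitary (u : cmxfun) : Prop :=
  cmxfun_star u * u = 1 /\ u * cmxfun_star u = 1.

Definition ad (u a : cmxfun) : cmxfun := cmxfun_star u * a * u.

Definition tracial_state (tau : {scalar cmxfun}) : Prop :=
  [/\ tau 1 = 1,
      forall a : cmxfun, 0 <= tau (cmxfun_star a * a)
    & forall a b : cmxfun, tau (a * b) = tau (b * a)].

Definition cvnorm (v : 'cV[R[i]]_n) : R :=
  Num.sqrt (\sum_i ComplexField.Normc.normc (v i 0) ^+ 2).

(* [ `|M| ] on matrices is the largest modulus of an entry, not the C*-norm. *)
Definition mx_opnorm (M : 'M[R[i]]_n) : R :=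
  sup [set cvnorm (M *m v) | v in [set v | cvnorm v <= 1]].

Definition cmxfun_norm (a : cmxfun) : R := sup [set mx_opnorm (a t) | t in setT].

End MatrixFunctionAlgebra.
Arguments cmxfun : clear implicits.

Record unital_star_hom (R : realType) (X T : topologicalType) (n : nat) :=
  UnitalStarHom {
    star_hom_fun :> {rmorphism cfun R X -> cmxfun R T n};
    star_homZ : scalable star_hom_fun;
    star_homV : forall f, star_hom_fun (cfun_star f) = cmxfun_star (star_hom_fun f)
  }.

Section UnitInterval.
Variable R : realType.

Definition unit_interval := set_type (`[0, 1]%classic : set R).
HB.instance Definition _ := Topological.on unit_interval.

Let zero_in : (0 : R) \in `[0, 1]%classic.
Proof. by rewrite inE /= in_itv /= lexx ler01. Qed.

Let one_in : (1 : R) \in `[0, 1]%classic.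
Proof. by rewrite inE /= in_itv /= lexx ler01. Qed.

Let zero_one : (SigSub zero_in : unit_interval) != SigSub one_in.
Proof. by rewrite -val_eqE /= eq_sym oner_eq0. Qed.

HB.instance Definition _ := isBiPointed.Build unit_interval zero_one.

End UnitInterval.

Definition path_connected (R : realType) (X : topologicalType) : Prop :=
  forall x y : X, inhabited {path (unit_interval R) from x to y}.

Unset Implicit Arguments.

Section CW.
Variable R : realType.

Definition sq_enorm {d} (v : 'rV[R]_d) : R := \sum_j v 0 j ^+ 2.
Definition closed_disc (d : nat) : set 'rV[R]_d := [set v | sq_enorm v <= 1].
Definition open_disc (d : nat) : set 'rV[R]_d := [set v | sq_enorm v < 1].
Definition disc_sphere (d : nat) : set 'rV[R]_d := [set v | sq_enorm v = 1].

(* A cell decomposition of [X] with finitely many cells, given by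
   characteristic maps of discs. Only the values of a characteristic map on
   the closed disc are meaningful. *)
Record finite_cw_structure (X : topologicalType) := FiniteCWStructure {
  cell : finType;
  cell_dim : cell -> nat;
  cell_map : forall e : cell, 'rV[R]_(cell_dim e) -> X;
  cell_map_continuous : forall e,
    {within closed_disc (cell_dim e), continuous (cell_map e)};
  cell_map_inj : forall e, {in open_disc (cell_dim e) &, injective (cell_map e)};
  (* the inverse of [cell_map e] on the open cell is continuous *)
  cell_map_open : forall e (V : set 'rV[R]_(cell_dim e)), open V ->
    exists2 W : set X, open W &
      cell_map e @` (V `&` open_disc (cell_dim e)) =
      W `&` cell_map e @` open_disc (cell_dim e);
  cell_partition : forall x : X,
    exists! e, (cell_map e @` open_disc (cell_dim e)) x;
  cell_boundary : forall e v, disc_sphere (cell_dim e) v ->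
    exists2 e', (cell_dim e' < cell_dim e)%N &
      (cell_map e' @` open_disc (cell_dim e')) (cell_map e v);
  cell_weak_topology : forall A : set X,
    (forall e, closed (A `&` cell_map e @` closed_disc (cell_dim e))) -> closed A
}.

Definition finite_cw_complex (X : topologicalType) : Prop :=
  hausdorff_space X /\ inhabited (finite_cw_structure X).

End CW.

(* Main.v *)
(* At each t the images of finitely many functions under phi and psi are
   simultaneously diagonalizable, and tracial closeness on suitable test
   functions forces their joint eigenvalues to be matched up to a small error;
   this gives a unitary V(t) with V(t)^* phi(f)(t) V(t) close to psi(f)(t), not
   necessarily continuous in t. For consecutive points of a fine mesh,
   Y = V(t_k)^* V(t_(k+1)) almost commutes with psi(f)(t). As n is fixed, the
   spectrum of Y misses an arc of definite length, so Y is joined to 1 by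
   unitaries in the algebra it generates, which still almost commute with
   psi(f)(t). Running through these paths gives a continuous U agreeing with V
   at 0 and 1, where V may be taken to be 1 if phi and psi agree there. *)
From HB Require Import structures.
Require Import Defs.
From mathcomp Require Import all_boot all_order all_algebra all_fingroup.
From mathcomp Require Import complex.
From mathcomp Require Import all_classical all_reals all_analysis.
From mathcomp Require Import ring lra.

Set Implicit Arguments.
Unset Strict Implicit.
Unset Printing Implicit Defensive.

Import Order.TTheory GRing.Theory Num.Theory numFieldNormedType.Exports.

Local Open Scope classical_set_scope.
Local Open Scope sesquilinear_scope.
Local Open Scope ring_scope.

(** * Entrywise bounds and unitary matrices *)

Section EntryBound.
Context {C : numClosedFieldType}.

(** Entrywise bounds stand in for the operator norm. As [n] is fixed, each product or conjugation
    costs only a power of [n], and the passage to the operator norm is made once, in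
    [mx_opnorm_le]. *)
Definition mxbound {m n} (c : C) (A : 'M[C]_(m, n)) :=
  forall i j, `|A i j| <= c.

Lemma mxboundD m n (a b : C) (A B : 'M[C]_(m, n)) :
  mxbound a A -> mxbound b B -> mxbound (a + b) (A + B).
Proof.
by move=> hA hB i j; rewrite mxE (le_trans (ler_normD _ _))// lerD.
Qed.

Lemma mxboundN m n (a : C) (A : 'M[C]_(m, n)) : mxbound a A -> mxbound a (- A).
Proof. by move=> hA i j; rewrite mxE normrN. Qed.

Lemma mxboundM m n p (a b : C) (A : 'M[C]_(m, n)) (B : 'M[C]_(n, p)) :
  mxbound a A -> mxbound b B -> mxbound (n%:R * (a * b)) (A *m B).
Proof.
move=> hA hB i j; rewrite mxE (le_trans (ler_norm_sum _ _ _))//.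
rewrite (@le_trans _ _ (\sum_(k < n) (a * b)))//.
  by apply: ler_sum => k _; rewrite normrM ler_pM.
by rewrite sumr_const card_ord mulr_natl.
Qed.

Lemma mxbound_unitary n (U : 'M[C]_n) : U \is unitarymx -> mxbound 1 U.
Proof.
move=> /unitarymxP/matrixP hU i j.
rewrite -(@expr_le1 _ 2)//; have := hU i i; rewrite !mxE eqxx mulr1n => <-.
rewrite (bigD1 j)//= !mxE -normCK lerDl sumr_ge0// => k _.
by rewrite !mxE -normCK exprn_ge0.
Qed.

Lemma mxbound_unitaryl n (a : C) (U A : 'M[C]_n) :
  U \is unitarymx -> mxbound a A -> mxbound (n%:R * a) (U *m A).
Proof.
by move=> /mxbound_unitary hU hA; have := mxboundM hU hA; rewrite mul1r.
Qed.

Lemma mxbound_unitaryr n (a : C) (U A : 'M[C]_n) :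
  U \is unitarymx -> mxbound a A -> mxbound (n%:R * a) (A *m U).
Proof.
by move=> /mxbound_unitary hU hA; have := mxboundM hA hU; rewrite mulr1.
Qed.

Lemma mxbound_conj n (a : C) (U V A : 'M[C]_n) : U \is unitarymx ->
  V \is unitarymx -> mxbound a A -> mxbound (n%:R ^+ 2 * a) (U *m A *m V).
Proof.
move=> hU hV hA; rewrite expr2 -mulrA.
by apply: mxbound_unitaryr => //; exact: mxbound_unitaryl.
Qed.

Lemma unitarymx_adj n (U : 'M[C]_n) : U \is unitarymx -> U ^t* *m U = 1%:M.
Proof. by move=> /unitarymxP/mulmx1C. Qed.

Lemma unitarymx_inv n (U : 'M[C]_n) : U \is unitarymx -> U ^t* \is unitarymx.
Proof. by rewrite trmxC_unitary. Qed.

Lemma unitarymx1 n : (1%:M : 'M[C]_n) \is unitarymx.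
Proof. by apply/unitarymxP; rewrite trmx1 map_mx1 mulmx1. Qed.

Lemma unitarymx_diag n (d : 'rV[C]_n) :
  (forall i, `|d 0 i| = 1) -> diag_mx d \is unitarymx.
Proof.
move=> hd; apply/unitarymxP/matrixP => i j.
rewrite tr_diag_mx map_diag_mx mulmx_diag !mxE -normCK hd expr1n.
by [].
Qed.

Lemma unitarymx_conjK n (P A : 'M[C]_n) : P \is unitarymx ->
  P ^t* *m (P *m A *m P ^t*) *m P = A.
Proof.
move=> hP; rewrite !mulmxA unitarymx_adj// mul1mx -mulmxA unitarymx_adj//.
by rewrite mulmx1.
Qed.

Lemma conjmx_diag_entry n (P A : 'M[C]_n) (d : 'rV[C]_n) i j :
  P \is unitarymx ->
  (P *m ((P ^t* *m diag_mx d *m P) *m A - A *m (P ^t* *m diag_mx d *m P))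
    *m P ^t*) i j = (d 0 i - d 0 j) * (P *m A *m P ^t*) i j.
Proof.
move=> hP; have hP' := unitarymxP hP.
rewrite mulmxBr mulmxBl !mulmxA hP' mul1mx.

rewrite -[X in _ - X](mulmxA _ P) hP' mulmx1; set B := P *m A *m P ^t*.
rewrite (_ : diag_mx d *m P *m A *m P ^t* = diag_mx d *m B).
  by rewrite mul_diag_mx mul_mx_diag !mxE mulrBl [X in _ - X]mulrC.
by rewrite /B !mulmxA.
Qed.

(** In the basis that diagonalizes [D] and [E], commutation with them multiplies the entry (i, j) by
    [d_i - d_j] and [e_i - e_j] respectively. Entering and leaving this basis costs a factor [n ^ 2]
    each time. *)
Lemma commutator_bound n (P A : 'M[C]_n) (d e : 'rV[C]_n) (L c : C) :
    P \is unitarymx -> 0 <= L ->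
    (forall i j, `|e 0 i - e 0 j| <= L * `|d 0 i - d 0 j|) ->
  let D := P ^t* *m diag_mx d *m P in
  let E := P ^t* *m diag_mx e *m P in
  mxbound c (D *m A - A *m D) ->
  mxbound (n%:R ^+ 4 * L * c) (E *m A - A *m E).
Proof.
move=> hP L0 hL D E hD; have hP' := unitarymx_inv hP.
rewrite -(unitarymx_conjK (E *m A - A *m E) hP).
have -> : n%:R ^+ 4 * L * c = n%:R ^+ 2 * (L * (n%:R ^+ 2 * c)) by ring.
apply: mxbound_conj => // i j; rewrite conjmx_diag_entry// normrM.
rewrite (le_trans (ler_wpM2r _ (hL i j)))// -mulrA ler_wpM2l// -normrM.
by rewrite -conjmx_diag_entry//; exact: mxbound_conj.
Qed.

End EntryBound.

(** * The Cayley transform on the unit circle *)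

Section Cayley.
Context {C : numClosedFieldType}.
Implicit Types s z w : C.

(** For z = exp(i t) this is i tan(t/2). [cayley_path] scales this imaginary number by [s] and maps
    it back to the circle, so z moves to 1 without crossing -1. *)
Definition cayley_log z : C := (z - 1) / (z + 1).

Definition cayley_path s z : C :=
  (1 + s * cayley_log z) / (1 - s * cayley_log z).

Lemma conj_cayley_log z : `|z| = 1 -> z + 1 != 0 ->
  (cayley_log z)^* = - cayley_log z.
Proof.
move=> z1 zN1; have z0 : z != 0 by rewrite -normr_gt0 z1.
have zJ : z^* = z^-1.
  by apply: (mulfI z0); rewrite -normCK z1 expr1n divff.
rewrite /cayley_log rmorphM/= fmorphV/= rmorphB rmorphD/= rmorph1 zJ.
by field; rewrite zN1 z0.
Qed.

(** The number [s * cayley_log z] is purely imaginary, so the squared modulus is 1 plus a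
    nonnegative term. *)
Lemma cayley_den_ge1 s z : s \is Num.real -> `|z| = 1 -> z + 1 != 0 ->
  1 <= `|1 - s * cayley_log z|.
Proof.
move=> /CrealP sr z1 zN1; rewrite -(@expr_ge1 _ 2)// normCK.
rewrite rmorphB rmorphM/= rmorph1 sr conj_cayley_log//.
set y := cayley_log z.
have -> : (1 - s * y) * (1 - s * - y) = 1 + (s * s) * (- (y * y)) by ring.
rewrite lerDl; apply: mulr_ge0; last first.
  by rewrite -mulrN -conj_cayley_log// -normCK exprn_ge0.
by rewrite -[X in _ * X]sr -normCK exprn_ge0.
Qed.

Lemma cayley_den_neq0 s z : s \is Num.real -> `|z| = 1 -> z + 1 != 0 ->
  1 - s * cayley_log z != 0.
Proof.
move=> sr z1 zN1; rewrite -normr_gt0.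
exact: lt_le_trans ltr01 (cayley_den_ge1 sr z1 zN1).
Qed.

Lemma norm_cayley_path s z : s \is Num.real -> `|z| = 1 -> z + 1 != 0 ->
  `|cayley_path s z| = 1.
Proof.
move=> sr z1 zN1; rewrite normrM normfV.
have -> : 1 + s * cayley_log z = (1 - s * cayley_log z)^*.
  rewrite rmorphB rmorphM/= rmorph1 conj_cayley_log// mulrN opprK.
  by rewrite (CrealP sr).
by rewrite norm_conjC divff// normr_eq0 cayley_den_neq0.
Qed.

Lemma cayley_path0 z : cayley_path 0 z = 1.
Proof. by rewrite /cayley_path !mul0r subr0 addr0 divff// oner_neq0. Qed.

Lemma cayley_path1 z : `|z| = 1 -> z + 1 != 0 -> cayley_path 1 z = z.
Proof.
move=> z1 zN1; have := cayley_den_neq0 (@real1 C) z1 zN1.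
rewrite /cayley_path !mul1r => h; apply: (mulIf h); rewrite divfK//.
by rewrite /cayley_log; field.
Qed.

(** The map a -> (1 + a) / (1 - a) is 2-Lipschitz on the imaginary axis, where its denominators have
    modulus at least 1, and [cayley_log] has Lipschitz constant 2 / k^2 at distance [k] from -1. *)
Lemma cayley_path_lip (k s z w : C) : 0 <= s <= 1 -> 0 < k ->
    `|z| = 1 -> `|w| = 1 -> k <= `|z + 1| -> k <= `|w + 1| ->
  `|cayley_path s z - cayley_path s w| <= 4 / k ^+ 2 * `|z - w|.
Proof.
move=> /andP[s0 s1] k0 z1 w1 kz kw.
have z0 : z + 1 != 0 by rewrite -normr_gt0 (lt_le_trans k0).
have w0 : w + 1 != 0 by rewrite -normr_gt0 (lt_le_trans k0).
have sr : s \is Num.real by apply: ger0_real.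
have dz := cayley_den_neq0 sr z1 z0; have dw := cayley_den_neq0 sr w1 w0.
have nz := cayley_den_ge1 sr z1 z0; have nw := cayley_den_ge1 sr w1 w0.
have -> : cayley_path s z - cayley_path s w =
    2 * s * (cayley_log z - cayley_log w) /
      ((1 - s * cayley_log z) * (1 - s * cayley_log w)).
  by rewrite /cayley_path; move: dz dw; move: (cayley_log z) (cayley_log w) =>
    a b dz dw; field; rewrite dz dw.
have -> : cayley_log z - cayley_log w = 2 * (z - w) / ((z + 1) * (w + 1)).
  by rewrite /cayley_log; field; rewrite z0 w0.
rewrite !normrM !normfV !normrM (ger0_norm s0) !normr_nat.
have -> : 4 / k ^+ 2 * `|z - w| = (2 * 1 * (2 * `|z - w| * (k * k)^-1)) * 1.
  by field; rewrite gt_eqF.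
have p0 : 0 < `|z + 1| * `|w + 1| by rewrite mulr_gt0 ?normr_gt0.
apply: ler_pM => //.
- by rewrite !mulr_ge0// invr_ge0 mulr_ge0.
- apply: ler_pM => //.
  + by rewrite mulr_ge0.
  + by rewrite ler_wpM2l.
  + rewrite ler_wpM2l ?mulr_ge0// lef_pV2 ?posrE ?mulr_gt0 ?normr_gt0//.
    by rewrite ler_pM// ltW.
- rewrite -[leRHS]invr1 lef_pV2 ?posrE ?mulr_gt0 ?normr_gt0//.
  by rewrite -[leLHS]mulr1 ler_pM.
Qed.

(** The inverse of 1 plus the sum of all inverses works; the 1 also covers an empty [T]. *)
Lemma pos_lower_bound (T : finType) (f : T -> C) : (forall t, 0 < f t) ->
  exists2 k : C, 0 < k & forall t, k <= f t.
Proof.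
move=> f0; have S0 : 0 <= \sum_t (f t)^-1.
  by apply: sumr_ge0 => t _; rewrite invr_ge0 ltW.
have S1 : 0 < 1 + \sum_t (f t)^-1 by rewrite ltr_pwDl.
exists (1 + \sum_t (f t)^-1)^-1 => [|t]; first by rewrite invr_gt0.
rewrite -[leRHS]invrK lef_pV2 ?posrE ?invr_gt0//.
rewrite (bigD1 t)//= addrCA lerDl addr_ge0//.
by apply: sumr_ge0 => u _; rewrite invr_ge0 ltW.
Qed.

(** The inverse Cayley transform of i j: this yields infinitely many distinct points of the circle,
    none equal to -1, without trigonometry. *)
Definition circle_pt (j : nat) : C := (1 + 'i * j%:R) / (1 - 'i * j%:R).

Lemma circle_pt_den (j : nat) : 1 - 'i * j%:R != 0 :> C.
Proof.
apply/eqP => /(congr1 (fun z => z * z^*)); rewrite mul0r -normCK.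
have -> : `|1 - 'i * j%:R| ^+ 2 = 1 + j%:R ^+ 2 :> C.
  have := @normC2_rect C 1 (- j%:R); rewrite mulrN sqrrN expr1n; apply.
    exact: real1.
  by rewrite realN.
by apply/eqP; rewrite gt_eqF// ltr_pwDl// exprn_ge0.
Qed.

Lemma norm_circle_pt j : `|circle_pt j| = 1.
Proof.
rewrite normrM normfV.
have -> : 1 + 'i * j%:R = (1 - 'i * j%:R)^* :> C.
  by rewrite rmorphB rmorphM/= rmorph1 conjCi conjC_nat mulNr opprK.
by rewrite norm_conjC divff// normr_eq0 circle_pt_den.
Qed.

Lemma circle_pt_inj : injective circle_pt.
Proof.
move=> j l /eqP; rewrite -subr_eq0 => h.
apply/eqP; rewrite -(eqr_nat C) -subr_eq0; move: h.
have -> : circle_pt j - circle_pt l = 2 * 'i * (j%:R - l%:R) /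
    ((1 - 'i * j%:R) * (1 - 'i * l%:R)).
  by rewrite /circle_pt; field; rewrite !circle_pt_den.
rewrite !mulf_eq0 invr_eq0 mulf_eq0 !(negPf (circle_pt_den _)) !orbF.
by rewrite pnatr_eq0/= (negPf (neq0Ci _)).
Qed.

Lemma circle_ptN1 j : circle_pt j + 1 != 0.
Proof.
have -> : circle_pt j + 1 = 2 / (1 - 'i * j%:R).
  by rewrite /circle_pt; field; rewrite circle_pt_den.
by rewrite mulf_neq0 ?invr_neq0 ?circle_pt_den// pnatr_eq0.
Qed.

(* Pigeonhole: each z_i is close to the opposite of at most one of the n + 1
   separated points c_0, ..., c_n. *)
Lemma circle_gap (n : nat) : exists2 k : C, 0 < k &
  forall z : 'I_n -> C, (forall i, `|z i| = 1) ->
  exists c : C, [/\ `|c| = 1, c + 1 != 0 & forall i, k <= `|z i / c + 1|].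
Proof.
(* Here [k] is at most half the distance between any two of the points; on the diagonal the value 1
   is a placeholder that keeps the family positive. *)
have [[j l]|k k0 hk] := @pos_lower_bound ('I_n.+1 * 'I_n.+1)%type
  (fun p => if p.1 == p.2 then 1 else `|circle_pt p.1 - circle_pt p.2| / 2).
  rewrite /=; case: ifPn => // jl.
  rewrite divr_gt0// normr_gt0 subr_eq0.
  by apply: contraNneq jl => /circle_pt_inj /val_inj ->.
exists k => // z z1; have [[j hj]|H] := pselect
    (exists j : 'I_n.+1, forall i, k <= `|z i / circle_pt j + 1|).
  by exists (circle_pt j); rewrite norm_circle_pt circle_ptN1.
have {}H (j : 'I_n.+1) : exists i, `|z i + circle_pt j| < k.
  apply: contrapT => hj; apply: H; exists j => i.
  have cj0 : circle_pt j != 0 by rewrite -normr_gt0 norm_circle_pt.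
  have -> : z i / circle_pt j + 1 = (z i + circle_pt j) / circle_pt j by field.
  rewrite normrM normfV norm_circle_pt invr1 mulr1.
  rewrite real_leNgt ?normr_real ?gtr0_real//; apply/negP => lt.
  by apply: hj; exists i.
have [g hg] := choice H.
(* Otherwise every one of the n + 1 points has some -z_i within [k]. Two points sharing the same z_i
   would be less than 2k apart. *)
suff /inj_leq : injective g by rewrite ltnn.
move=> j l gjl; apply/eqP/negPn/negP => jl.
have := hk (j, l); rewrite /= (negPf jl) ler_pdivlMr// => hjl.
have dE : circle_pt j - circle_pt l =
    (z (g j) + circle_pt j) - (z (g l) + circle_pt l) by rewrite gjl; ring.
have lt2 : `|circle_pt j - circle_pt l| < k + k.
  by rewrite dE (le_lt_trans (ler_normB _ _))// ltrD.
by have := le_lt_trans hjl lt2; rewrite mulr_natr mulr2n ltxx.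
Qed.

End Cayley.

(** * Paths of unitaries *)

Section Continuity.
Context {R : realType}.

Lemma continuousC_inv (T : topologicalType) (f : T -> R[i]) :
  (forall x, f x != 0) -> continuous f -> continuous (fun x => (f x)^-1).
Proof.
by move=> f0 cf x; exact: (@cvgV R[i] T (nbhs x) _ f _ (f0 x) (cf x)).
Qed.

Lemma continuous_real_complex : continuous (fun x : R => x%:C%C).
Proof.
move=> x; apply/(@cvgrPdist_lt _ (R[i]^o) R (nbhs x) _) => e e0.
have eE : e = (complex.Re e)%:C%C by rewrite RRe_real// gtr0_real.
have r0 : 0 < complex.Re e by rewrite -ltcR -eE.
near=> y; rewrite -rmorphB normc_def/= expr0n addr0 sqrtr_sqr eE ltcR.
near: y; exact: (@cvgrPdist_lt _ R^o R (nbhs x) _ id x).1.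
Unshelve. all: by end_near. Qed.

Lemma continuous_mxmul (T : topologicalType) m n p
    (f : T -> 'M[R[i]]_(m, n)) (g : T -> 'M[R[i]]_(n, p)) :
  continuous f -> continuous g -> continuous (fun x => f x *m g x).
Proof.
move=> /continuous_mxP cf /continuous_mxP cg; apply/continuous_mxP => i j.
under eq_fun do rewrite mxE.
by apply: continuousC_sum => k; exact: continuousC_mul.
Qed.

End Continuity.

Section UnitaryPath.
Context {R : realType}.
Local Notation C := R[i].

Lemma continuous_cayley_path (z : C) : `|z| = 1 -> z + 1 != 0 ->
  continuous (fun s : R => cayley_path s%:C%C z).
Proof.
move=> z1 zN1; apply: continuousC_mul.
  apply: continuousC_add; first exact: cst_continuous.
  apply: continuousC_mul; last exact: cst_continuous.
  exact: continuous_real_complex.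
apply: continuousC_inv => [s|].
  by rewrite cayley_den_neq0//; apply/complex_realP; exists s.
apply: continuousC_add; first exact: cst_continuous.
apply: continuousC_opp.
apply: continuousC_mul; last exact: cst_continuous.
exact: continuous_real_complex.
Qed.

(** A unitary is normal, hence unitarily diagonalizable; its diagonal form is again unitary, which
    forces eigenvalues of modulus 1. *)
Lemma unitarymx_spectral n (Y : 'M[C]_n) : Y \is unitarymx ->
  exists P (d : 'rV[C]_n), [/\ P \is unitarymx, forall i, `|d 0 i| = 1 &
    Y = P ^t* *m diag_mx d *m P].
Proof.
move=> hY; have /orthomx_spectralP YE : Y \is normalmx.
  by apply/normalmxP; rewrite unitarymx_adj// (unitarymxP hY).
have hP := spectral_unitarymx Y.
exists (spectralmx Y), (spectral_diag Y); move: YE; rewrite invmx_unitary//.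
move: (spectralmx Y) (spectral_diag Y) hP => P d hP YE; split=> // i.
have dE : diag_mx d = P *m Y *m P ^t*.
  by rewrite YE !mulmxA (unitarymxP hP) mul1mx -mulmxA (unitarymxP hP) mulmx1.
have : diag_mx d \is unitarymx.
  by rewrite dE; exact: (mul_unitarymx (mul_unitarymx hP hY) (unitarymx_inv hP)).
move=> /unitarymxP/matrixP/(_ i i); rewrite tr_diag_mx map_diag_mx mulmx_diag.
rewrite !mxE eqxx !mulr1n -normCK => /eqP; rewrite pexpr_eq1//.
by move=> /eqP.
Qed.

(* The spectrum of a unitary of size n misses an arc of length bounded below
   in terms of n; retracting the complement of that arc to 1 is Lipschitz on
   the spectrum, so commutators grow by at most a constant along the path. *)
Lemma unitary_path n : exists2 K : C, 0 <= K &
  forall Y : 'M[C]_n, Y \is unitarymx -> exists G : R -> 'M[C]_n,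
  [/\ continuous G, forall s, G s \is unitarymx, G 0 = 1%:M, G 1 = Y &
      forall s A c, 0 <= s <= 1 -> mxbound c (Y *m A - A *m Y) ->
        mxbound (K * c) (G s *m A - A *m G s)].
Proof.
have [k k0 hk] := @circle_gap C n.
have L0 : 0 <= 4 / k ^+ 2 by rewrite divr_ge0// exprn_ge0// ltW.
exists (n%:R ^+ 4 * (4 / k ^+ 2)); first by rewrite mulr_ge0// exprn_ge0.
move=> Y /unitarymx_spectral[P [d [hP d1 ->]]].
have [c [c1 cN1 hc]] := hk (fun i => d 0 i) d1.
have dc1 i : `|d 0 i / c| = 1 by rewrite normrM normfV d1 c1 divr1.
have dcN1 i : d 0 i / c + 1 != 0.
  by rewrite -normr_gt0 (lt_le_trans k0).
have c0 : c != 0 by rewrite -normr_gt0 c1.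
(* Dividing by [c] moves the spectrum away from -1, where the Cayley path applies; the factor [c] is
   itself joined to 1, which makes [g 0] constantly 1 and [g 1 = d]. *)
pose g (s : R) := \row_i (cayley_path s%:C%C c * cayley_path s%:C%C (d 0 i / c)).
have sreal (s : R) : s%:C%C \is Num.real by apply/complex_realP; exists s.
have g1 s i : `|g s 0 i| = 1.
  by rewrite mxE normrM !norm_cayley_path// mulr1.
exists (fun s => P ^t* *m diag_mx (g s) *m P); split.
- apply: continuous_mxmul; last exact: cst_continuous.
  apply: continuous_mxmul; first exact: cst_continuous.
  apply/continuous_mxP => i j; under eq_fun do rewrite !mxE.
  case: (i == j); last by under eq_fun do rewrite mulr0n; exact: cst_continuous.
  under eq_fun do rewrite mulr1n.
  by apply: continuousC_mul; exact: continuous_cayley_path.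
- move=> s; have hPg := mul_unitarymx (unitarymx_inv hP) (unitarymx_diag (g1 s)).
  exact: (mul_unitarymx hPg hP).
- rewrite (_ : g 0 = const_mx 1) ?diag_const_mx ?mulmx1 ?unitarymx_adj//.
  by apply/rowP => i; rewrite !mxE !cayley_path0 mulr1.
- rewrite (_ : g 1 = d)//.
  by apply/rowP => i; rewrite !mxE !cayley_path1// mulrC divfK.
- move=> s A b s01; apply: commutator_bound => // i j.
  (* The path of [c] is a common factor of modulus 1 and drops out of the differences. *)
  rewrite !mxE -mulrBr normrM norm_cayley_path// mul1r.
  have -> : `|d 0 i - d 0 j| = `|d 0 i / c - d 0 j / c|.
    by rewrite -mulrBl normrM normfV c1 divr1.
  by apply: cayley_path_lip => //; rewrite ler0c -[1]/(1%:C%C) lecR.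
Qed.

End UnitaryPath.

(** * Gluing pointwise unitaries into a continuous one *)

Section Patching.
Context {R : realType}.
Local Notation C := R[i].

Definition clamp (x : R) : R := Num.max 0 (Num.min 1 x).

Lemma clamp_itv x : 0 <= clamp x <= 1.
Proof. by rewrite /clamp le_max lexx/= ge_max ler01 ge_min lexx. Qed.

Lemma clamp_id x : 0 <= x <= 1 -> clamp x = x.
Proof. by move=> /andP[x0 x1]; rewrite /clamp min_r// max_r. Qed.

Lemma clamp_le0 x : x <= 0 -> clamp x = 0.
Proof.
by move=> x0; rewrite /clamp min_r ?max_l// (le_trans x0).
Qed.

Lemma clamp_ge1 x : 1 <= x -> clamp x = 1.
Proof. by move=> x1; rewrite /clamp min_l// max_r. Qed.

Lemma continuous_clamp : continuous clamp.
Proof.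
move=> x; apply: (@continuous_max R R (cst 0)); first exact: cst_continuous.
by apply: continuous_min; [exact: cst_continuous|exact: cvg_id].
Qed.

Lemma cell_index (N : nat) (x : R) : 0 <= x <= N.+1%:R ->
  exists2 k, (k <= N)%N & k%:R <= x <= k.+1%:R.
Proof.
elim: N => [|N IH] xN; first by exists 0.
have [xle|xgt] := leP x N.+1%:R.
  have [|k kN hk] := IH; last by exists k => //; exact: leq_trans kN _.
  by rewrite xle andbT; case/andP: xN.
by exists N.+1 => //; rewrite ltW//=; case/andP: xN.
Qed.

(* Multiplying the paths, each run during its own unit time interval, avoids
   gluing continuous functions. *)
Lemma concatenated_path n (N : nat) (V : nat -> 'M[C]_n)
    (G : nat -> R -> 'M[C]_n) :
    (forall k, V k \is unitarymx) -> (forall k, continuous (G k)) ->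
    (forall k s, G k s \is unitarymx) -> (forall k, G k 0 = 1%:M) ->
    (forall k, G k 1 = (V k) ^t* *m V k.+1) ->
  exists U : R -> 'M[C]_n, [/\ continuous U, forall x, U x \is unitarymx &
    forall k x, (k <= N)%N -> k%:R <= x <= k.+1%:R ->
      U x = V k *m G k (x - k%:R)].
Proof.
move=> hV cG hG G0 G1.
pose U := fix U (m : nat) (x : R) : 'M[C]_n :=
  if m is k.+1 then U k x *m G k (clamp (x - k%:R)) else V 0%N.
exists (U N.+1); split.
- elim: N.+1 => [|m IH]; first exact: cst_continuous.
  have cGm : continuous (fun x : R => G m (clamp (x - m%:R))).
    move=> x.
    apply: (@continuous_comp _ _ _ (fun x : R => clamp (x - m%:R)) (G m));
      last exact: cG.
    apply: (@continuous_comp _ _ _ (fun x : R => x - m%:R) clamp);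
      last exact: continuous_clamp.
    by apply: continuousB; [exact: cvg_id|exact: cst_continuous].
  exact: (@continuous_mxmul R _ n n n (U m)
    (fun x : R => G m (clamp (x - m%:R))) IH cGm).
- move=> x; elim: N.+1 => [|m IH]; first exact: hV.
  exact: (mul_unitarymx IH (hG _ _)).
(* Once the first [m] paths have been run, the product telescopes; before its own interval starts, a
   factor is still 1. *)
have Ule m x : m%:R <= x -> U m x = V m.
  elim: m => [|m IH] //= mx.
  rewrite IH; last by rewrite (le_trans _ mx)// ler_nat.
  rewrite clamp_ge1 ?G1 ?mulmxA ?(unitarymxP (hV m)) ?mul1mx//.
  by rewrite lerBrDr -natr1 addrC in mx *.
move=> k x kN hx; have : (k < N.+1)%N by [].
elim: N.+1 => [|m IH] //; rewrite ltnS leq_eqVlt => /orP[/eqP <-|km] /=.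
  rewrite Ule; last by case/andP: hx.
  by rewrite clamp_id// subr_ge0 lerBlDl natr1.
rewrite IH// clamp_le0 ?G0 ?mulmx1// subr_le0.
by case/andP: hx => _ /le_trans; apply; rewrite ler_nat.
Qed.

(** The order of quantifiers matters: [K] depends on [n] alone, so the tolerance [e] can be fixed
    first and the mesh chosen afterwards. *)
Lemma unitary_patching n : exists2 K : C, 0 <= K &
  forall (I : Type) (a b : I -> R -> 'M[C]_n) (e : C)
      (V : R -> 'M[C]_n) (N : nat),
    (forall t, V t \is unitarymx) ->
    (forall t, 0 <= t <= 1 ->
      forall f, mxbound e ((V t) ^t* *m a f t *m V t - b f t)) ->
    (forall s t, 0 <= s <= 1 -> 0 <= t <= 1 -> `|s - t| <= N.+1%:R^-1 ->
      forall f, mxbound e (a f s - a f t) /\ mxbound e (b f s - b f t)) ->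
  exists U : R -> 'M[C]_n,
    [/\ continuous U, forall t, U t \is unitarymx, U 0 = V 0, U 1 = V 1 &
        forall t, 0 <= t <= 1 ->
          forall f, mxbound (K * e) ((U t) ^t* *m a f t *m U t - b f t)].
Proof.
have [K0 K00 hK0] := @unitary_path R n.
(* [K1 * e] bounds the error at [t] when [V] is taken at a neighbouring node: [n ^ 2] for the
   conjugated oscillation of [a], 1 for the approximation at the node, 1 for the oscillation of [b].
   The final constant adds the conjugation of this error along the path and the commutator of the
   path with [b f t]. *)
pose K1 : C := n%:R ^+ 2 + 2.
exists ((n%:R ^+ 2 + 2 * n%:R ^+ 2 * K0) * K1).
  by rewrite mulr_ge0 ?addr_ge0 ?mulr_ge0// exprn_ge0.
move=> I a b e V N hV happrox hosc.
(* Nodes with k > N + 1 lie beyond 1; [V] is unitary on the whole line, so paths exist there too. *)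
pose W k := V (k%:R / N.+1%:R).
have hW k : W k \is unitarymx by exact: hV.
have [G hG] := choice (fun k =>
  hK0 _ (mul_unitarymx (unitarymx_inv (hW k)) (hW k.+1))).
have [U [cU hU UE]] := @concatenated_path n N W G hW
  (fun k => let: And5 h _ _ _ _ := hG k in h)
  (fun k => let: And5 _ h _ _ _ := hG k in h)
  (fun k => let: And5 _ _ h _ _ := hG k in h)
  (fun k => let: And5 _ _ _ h _ := hG k in h).
have N0 : (N.+1%:R : R) != 0 by rewrite pnatr_eq0.
have N0' : 0 < (N.+1%:R : R) by rewrite ltr0n.
exists (fun t => U (N.+1%:R * t)); split.
- move=> t; apply: continuous_comp; last exact: cU.
  by apply: continuousM; [exact: cst_continuous|exact: cvg_id].
- by move=> t; exact: hU.
- have [_ _ G0 _ _] := hG 0%N.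
  by rewrite mulr0 (UE 0%N) ?subr0 ?G0 ?mulmx1 /W ?mul0r// lexx ler01.
- have [_ _ _ G1 _] := hG N.
  rewrite mulr1 (UE N)//; last by rewrite ler_nat leqnSn lexx.
  rewrite -[N.+1%:R]natr1 addrAC subrr add0r G1 mulmxA.
  rewrite (unitarymxP (hW N)) mul1mx.
  by rewrite /W divff.
move=> t t01 f.
have [|k kN hk] := @cell_index N (N.+1%:R * t).
  by rewrite mulr_ge0 ?ler_piMr//; case/andP: t01.
have near_step j : (k <= j <= k.+1)%N -> mxbound (K1 * e)
    ((W j) ^t* *m a f t *m W j - b f t).
  move=> /andP[kj jk]; set s : R := j%:R / N.+1%:R.
  have s01 : 0 <= s <= 1.
    rewrite divr_ge0//= ler_pdivrMr// mul1r ler_nat.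
    exact: leq_trans jk _.
  have st : `|t - s| <= N.+1%:R^-1.
    have -> : t - s = (N.+1%:R * t - j%:R) / N.+1%:R.
      by rewrite mulrBl mulrAC divff// mul1r.
    rewrite normrM normfV normr_nat ler_pdivrMr// mulVf//.
    rewrite ler_norml; have : k%:R <= j%:R :> R by rewrite ler_nat.
    have : j%:R <= k.+1%:R :> R by rewrite ler_nat.
    by move: hk; rewrite -natr1 => /andP[]; lra.
  have [ha hb] := hosc t s t01 s01 st f.
  have -> : (W j) ^t* *m a f t *m W j - b f t =
      (W j) ^t* *m (a f t - a f s) *m W j +
      ((W j) ^t* *m a f s *m W j - b f s) - (b f t - b f s).
    by rewrite mulmxBr mulmxBl opprB !addrA !addrNK.
  have -> : K1 * e = n%:R ^+ 2 * e + e + e by rewrite /K1; ring.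
  apply: mxboundD; last exact: mxboundN.
  apply: mxboundD; last exact: happrox.
  by apply: mxbound_conj => //; exact: unitarymx_inv.
have hk0 := near_step k; have hk1 := near_step k.+1.
rewrite !leqnn !leqnSn in hk0 hk1; move: (hk0 isT) (hk1 isT) => {}hk0 {}hk1.
rewrite (UE k)//; set s := N.+1%:R * t - k%:R.
have s01 : 0 <= s <= 1 by rewrite subr_ge0 lerBlDl natr1.
have [_ hGk _ _ hGc] := hG k.
move: (hGk s) (hGc s (b f t)) => hGs /(_ (2 * n%:R * (K1 * e)) s01).
move: (a f t) (b f t) (W k) (W k.+1) (hW k) (hW k.+1) (G k s) hGs hk0 hk1.
move=> A B P Q hP hQ g hg hAP hAQ hcomm.
(* [P] and [Q] both almost conjugate [A] to [B], so [P ^t* *m Q] almost commutes with [B]; along the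
   path to it this persists up to the factor [K0]. *)
have {}hcomm : mxbound (K0 * (2 * n%:R * (K1 * e))) (g *m B - B *m g).
  apply: hcomm.
  have -> : P ^t* *m Q *m B - B *m (P ^t* *m Q) =
      (P ^t* *m A *m P - B) *m (P ^t* *m Q) -
        (P ^t* *m Q) *m (Q ^t* *m A *m Q - B).
    rewrite mulmxBl mulmxBr.
    rewrite (_ : P ^t* *m A *m P *m (P ^t* *m Q) = P ^t* *m A *m Q); last first.
      by rewrite mulmxA -(mulmxA _ P) (unitarymxP hP) mulmx1.
    rewrite (_ : P ^t* *m Q *m (Q ^t* *m A *m Q) = P ^t* *m A *m Q); last first.
      by rewrite !mulmxA -(mulmxA _ Q) (unitarymxP hQ) mulmx1.
    by rewrite opprB [RHS]addrC addrA addrNK.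
  have -> : 2 * n%:R * (K1 * e) = n%:R * (K1 * e) + n%:R * (K1 * e) by ring.
  have hPQ := mul_unitarymx (unitarymx_inv hP) hQ.
  apply: mxboundD; first exact: mxbound_unitaryr.
  by apply: mxboundN; exact: mxbound_unitaryl.
have -> : (P *m g) ^t* *m A *m (P *m g) - B =
    g ^t* *m (P ^t* *m A *m P - B) *m g - g ^t* *m (g *m B - B *m g).
  rewrite trmx_mul map_mxM !mulmxBr mulmxBl !mulmxA.
  by rewrite unitarymx_adj// mul1mx opprB addrA addrNK.
have -> : (n%:R ^+ 2 + 2 * n%:R ^+ 2 * K0) * K1 * e =
    n%:R ^+ 2 * (K1 * e) + n%:R * (K0 * (2 * n%:R * (K1 * e))) by ring.
have hg' := unitarymx_inv hg.
apply: mxboundD; first exact: (mxbound_conj hg' hg hAP).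
by apply: mxboundN; exact: mxbound_unitaryl.
Qed.

End Patching.

(** * Joint eigenvalues *)

(** The family enlarged by the adjoints still commutes, so one unitary triangularizes all of it. A
    matrix that is triangular together with its adjoint is diagonal. *)
Lemma joint_unitary_diag (C : numClosedFieldType) n m (A : 'I_m -> 'M[C]_n) :
    (forall j k, comm_mx (A j) (A k)) ->
    (forall j k, comm_mx (A j) ((A k) ^t*)) ->
  exists P (l : 'M[C]_(n, m)), P \is unitarymx /\
    forall j, A j = P ^t* *m diag_mx (col j l)^T *m P.
Proof.
move=> cA cAs.
have cAss j k : comm_mx ((A j) ^t*) ((A k) ^t*).
  rewrite /comm_mx -!map_mxM -!trmx_mul; congr (map_mx _ _^T).
  exact/esym/cA.
have [|P hP] := @cotrigonalization C n (codom A ++ codom (fun j => (A j) ^t*)).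
  move=> B D; rewrite !mem_cat => /orP[] /codomP[j ->] /orP[] /codomP[k ->] //.
  exact/esym/cAs.
move=> /allP /= trigA; exists P, (\matrix_(i, j) (P *m A j *m P ^t*) i i).
split=> // j.
have dE : P *m A j *m P ^t* =
    diag_mx (col j (\matrix_(i, j) (P *m A j *m P ^t*) i i))^T.
  apply/matrixP => i k; rewrite [RHS]mxE.
  rewrite 3![X in _ = X *+ _]mxE.
  have /trigA : A j \in codom A ++ codom (fun j => (A j) ^t*).
    by rewrite mem_cat codom_f.
  have /trigA : (A j) ^t* \in codom A ++ codom (fun j => (A j) ^t*).
    by rewrite mem_cat (codom_f (fun j => (A j) ^t*)) orbT.
  rewrite /similar_to /= !conjymx// => /is_trig_mxP tAs /is_trig_mxP tA.
  case: (ltngtP i k) => [ik|ki|/val_inj ->].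
  - by rewrite (ltn_eqF ik : (i == k) = false) mulr0n; exact: tA.
  - have := tAs _ _ ki => /(congr1 (fun z : C => z^*)); rewrite conjC0 => h.
    rewrite (gtn_eqF ki : (i == k) = false) mulr0n -[RHS]h.
    rewrite -[P *m _ *m P ^t*]trmxCK [LHS]mxE [X in X^*]mxE.
    by rewrite !trmx_mul !map_mxM trmxCK mulmxA.
  - by rewrite eqxx mulr1n.
by rewrite -dE unitarymx_conjK.
Qed.

(** * Test functions and matching of joint eigenvalues *)

Section TestFunction.
Context {C : numClosedFieldType} {m : nat}.

(** The product of the squared distances from [z] to the points of [S]. Being a polynomial in the
    coordinates and their conjugates, it can also be evaluated inside C(X), as [sep_fun]. *)
Definition sep_value (S : seq 'rV[C]_m) (z : 'rV[C]_m) : C :=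
  \prod_(q <- S) \sum_j (z 0 j - q 0 j) * (z 0 j - q 0 j)^*.

Lemma sep_value_mem S z : z \in S -> sep_value S z = 0.
Proof.
move=> zS; rewrite /sep_value; apply/eqP; rewrite prodf_seq_eq0; apply/hasP.
exists z => //=; apply/eqP; rewrite big1// => j _.
by rewrite subrr mul0r.
Qed.

Lemma sep_value_gt0 S z : z \notin S -> 0 < sep_value S z.
Proof.
move=> zS; rewrite /sep_value; elim: S zS => [|q S IH].
  by rewrite big_nil.
rewrite inE negb_or big_cons => /andP[zq zS]; rewrite mulr_gt0 ?IH//.
have [j hj] : exists j, z 0 j != q 0 j.
  apply/existsP; apply: contraNT zq; rewrite negb_exists => /forallP h.
  by apply/eqP/rowP => j; apply/eqP; have := h j; rewrite negbK.
rewrite (bigD1 j)//= ltr_wpDr//; last first.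
  by rewrite -normCK exprn_gt0// normr_gt0 subr_eq0.
by apply: sumr_ge0 => k _; rewrite -normCK exprn_ge0.
Qed.

(** Rows in [S] contribute 0, so the sum detects the multiplicity of [p] among the rows. *)
Lemma sum_sep_value_delta n (l : 'M[C]_(n, m)) (S : seq 'rV[C]_m) p :
    (forall i, row i l != p -> row i l \in S) ->
  \sum_i sep_value S (row i l) =
    (count_mem p [tuple row i l | i < n])%:R * sep_value S p.
Proof.
move=> hS; rewrite (bigID (fun i => row i l == p))/= [X in _ + X]big1 ?addr0.
  rewrite (eq_bigr (fun=> sep_value S p)); last by move=> i /eqP ->.
  rewrite sumr_const mulr_natl; congr (_ *+ _).
  by rewrite count_map -sum1_count -sum1_card big_enum_cond.
by move=> i hi; rewrite sep_value_mem// hS.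
Qed.

End TestFunction.

Section Matching.
Context {R : realType} {n m : nat}.
Local Notation C := R[i].

Lemma compact_complex_box (M : R) :
  exists2 K : set C, compact K & forall z : C, `|z| <= M%:C%C -> K z.
Proof.
exists ((fun p : R * R => p.1%:C%C + 'i * p.2%:C%C) @`
    (`[(- M), M] `*` `[(- M), M])).
  apply: continuous_compact; last first.
    by apply: compact_setX; exact: segment_compact.
  apply: continuous_subspaceT; apply: continuousC_add.
    move=> p; apply: (@continuous_comp _ _ _ fst (fun x : R => x%:C%C)).
      exact: cvg_fst.
    exact: continuous_real_complex.
  apply: continuousC_mul; first exact: cst_continuous.
  move=> p; apply: (@continuous_comp _ _ _ snd (fun x : R => x%:C%C)).
    exact: cvg_snd.
  exact: continuous_real_complex.
move=> z zM; exists (complex.Re z, complex.Im z); last first.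
  by rewrite /= -complexiE -complexE.
split; rewrite /= in_itv/= -ler_norml -lecR.
  exact: le_trans (normc_ge_Re z) zM.
rewrite -normrN -ReiNIm (le_trans (normc_ge_Re _))//.
by rewrite normrM complexiE normCi mulr1.
Qed.

(** A pair of eigenvalue matrices is one point of a product of copies of the complex numbers, the
    boolean naming the matrix, so that Tychonoff's theorem applies to bounded pairs. *)
Local Notation W := (prod_topology (fun _ : bool * 'I_n * 'I_m => C)).

Let entries (w : W) (b : bool) : 'M[C]_(n, m) := \matrix_(i, j) w (b, i, j).

Let matched (e : C) (l u : 'M[C]_(n, m)) :=
  exists s : {perm 'I_n}, forall i j, `|l i j - u (s i) j| <= e.

Let sep_diff (S : seq 'rV[C]_m) (l u : 'M[C]_(n, m)) : C :=
  \sum_i sep_value S (row i l) - \sum_i sep_value S (row i u).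

Lemma continuous_sep_diff S :
  continuous ((fun w => sep_diff S (entries w true) (entries w false)) :
    W -> R[i]).
Proof.
have cv b i :
    continuous ((fun w => sep_value S (row i (entries w b))) : W -> R[i]).
  rewrite /sep_value; elim: S => [|q S IH].
    rewrite (_ : (fun w : W => _) = fun=> 1); first exact: cst_continuous.
    by apply/funext => w; rewrite big_nil.
  pose f j (w : W) : R[i] := w (b, i, j) - q 0 j.
  pose f2 w : R[i] := \sum_j f j w * (f j w)^*.
  pose g w : R[i] := \prod_(q <- S) \sum_j (row i (entries w b) 0 j - q 0 j) *
    (row i (entries w b) 0 j - q 0 j)^*.
  rewrite (_ : (fun w : W => _) = fun w => f2 w * g w); last first.
    apply/funext => w; rewrite big_cons; congr (_ * _).
    by apply: eq_bigr => j _; rewrite !mxE.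
  have cj j : continuous (f j).
    apply: (@continuousC_add R W (fun w => w (b, i, j)) (fun=> - q 0 j)).
      exact: (@proj_continuous _ (fun _ : bool * 'I_n * 'I_m => C) (b, i, j)).
    exact: cst_continuous.
  apply: (@continuousC_mul R W f2 g _ IH).
  apply: (@continuousC_sum R W _ (fun j w => f j w * (f j w)^*)) => j.
  exact: (@continuousC_mul R W _ _ (cj j) (@continuousC_conj R W _ (cj j))).
pose g b i (w : W) : R[i] := sep_value S (row i (entries w b)).
apply: (@continuousC_add R W (fun w => \sum_i g true i w)
  (fun w => - \sum_i g false i w)).
  by apply: (@continuousC_sum R W _ (g true)) => i; exact: cv.
apply: (@continuousC_opp R W (fun w => \sum_i g false i w)).
by apply: (@continuousC_sum R W _ (g false)) => i; exact: cv.
Qed.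

(** Two cases. If the rows of the two matrices agree as multisets, a permutation matches them at [w]
    and nearly so around [w]. If not, some [p] has different multiplicities, and a test function
    separates the two sums throughout a neighbourhood. *)
Lemma local_matching (e : C) (w : W) : 0 < e ->
  exists (O : set W) (S : seq 'rV[C]_m) (d : R), [/\ nbhs w O, 0 < d &
    forall w', O w' ->
      `|sep_diff S (entries w' true) (entries w' false)| < d%:C%C ->
      matched e (entries w' true) (entries w' false)].
Proof.
move=> e0; set l := entries w true; set u := entries w false.
pose tl := [tuple row i l | i < n]; pose tu := [tuple row i u | i < n].
have [|npe] := boolP (perm_eq tl tu).
  move=> /tuple_permP[s hs].
  have {}hs i j : l i j = u (s i) j.
    have := congr1 (fun t : n.-tuple 'rV[C]_m => tnth t i 0 j) (val_inj hs).
    by rewrite !tnth_mktuple [LHS]mxE [RHS]mxE.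
  (* Here the neighbourhood alone forces the matching; the empty test list and [1] are default
     values. *)
  exists [set w' | forall k, `|w k - w' k| < e / 2], [::], 1; split=> //.
    apply: (@filter_forall W _ (fun k w' => `|w k - w' k| < e / 2) (nbhs w)
      (nbhs_filter w)) => k.
    have /(@cvgrPdist_lt _ (R[i]^o) W (nbhs w) _) :=
      @proj_continuous _ (fun _ : bool * 'I_n * 'I_m => C) k w.
    by apply; rewrite divr_gt0.
  move=> w' hw' _; exists s => i j; rewrite !mxE.
  have -> : w' (true, i, j) - w' (false, s i, j) =
      (w (false, s i, j) - w' (false, s i, j)) -
      (w (true, i, j) - w' (true, i, j)).
    by have := hs i j; rewrite !mxE => ->; ring.
  rewrite [e]splitr (le_trans (ler_normB _ _))// lerD// ltW//.
have [p _ hp] := allPn npe.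
(* The test function vanishes at all joint eigenvalues on either side except [p]. *)
pose S := [seq q <- tl ++ tu | q != p].
have hS (t : n.-tuple 'rV[C]_m) : {subset t <= tl ++ tu} ->
    forall q, q \in t -> q != p -> q \in S.
  by move=> ht q qt qp; rewrite mem_filter qp ht.
have pS : p \notin S by rewrite mem_filter eqxx.
have rE (k : 'M[C]_(n, m)) i : row i k \in [tuple row i k | i < n].
  by apply/mapP; exists i; rewrite ?mem_enum.
have dE : sep_diff S l u =
    ((count_mem p tl)%:R - (count_mem p tu)%:R) * sep_value S p.
  rewrite /sep_diff !(@sum_sep_value_delta _ _ _ _ _ p) ?mulrBl//.
    by move=> i; apply: (hS tu) => // q qt; rewrite mem_cat qt orbT.
  by move=> i; apply: (hS tl) => // q qt; rewrite mem_cat qt.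
have D0 : 0 < `|sep_diff S l u|.
  rewrite dE normrM mulr_gt0 ?normr_gt0 ?(gt_eqF (sep_value_gt0 pS))//.
  by rewrite subr_eq0 eqr_nat.
(* With half of the gap at [w], staying within [d] of that gap and being smaller than [d] contradict
   each other, so the matching near [w] holds vacuously. *)
pose d := ComplexField.Normc.normc (sep_diff S l u) / 2.
have dD : d%:C%C = `|sep_diff S l u| / 2.
  by rewrite /d rmorphM/= fmorphV/= rmorph_nat.
have d0 : 0 < d by rewrite -ltcR dD divr_gt0.
exists [set w' | `|sep_diff S l u -
    sep_diff S (entries w' true) (entries w' false)| < d%:C%C], S, d.
split=> //.
  have /(@cvgrPdist_lt _ (R[i]^o) W (nbhs w) _) := @continuous_sep_diff S w.
  by apply; rewrite dD divr_gt0.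
move=> w' /= h1 h2; have := ltrD h1 h2.
rewrite dD -splitr => /(le_lt_trans (ler_normD _ _)).
by rewrite subrK ltxx.
Qed.

(* If two multisets of joint eigenvalues differ, a test function vanishing at
   every point but one separates their sums; compactness makes this uniform. *)
Lemma eigenvalue_matching (M : R) (e : C) : 0 < e ->
  exists (Ss : seq (seq 'rV[C]_m)) (d : R), 0 < d /\
  forall l u : 'M[C]_(n, m), mxbound M%:C%C l -> mxbound M%:C%C u ->
    (forall S, S \in Ss -> `|\sum_i sep_value S (row i l) -
       \sum_i sep_value S (row i u)| < d%:C%C) ->
    exists s : {perm 'I_n}, forall i j, `|l i j - u (s i) j| <= e.
Proof.
move=> e0; have [K0 cK0 hK0] := compact_complex_box M.
have [nb hnb] := choice (fun w => local_matching w e0).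
have hfin (s : seq W) : exists (Ss : seq (seq 'rV[C]_m)) (d : R), 0 < d /\
    forall w w', w \in s -> nb w w' ->
      (forall S, S \in Ss ->
         `|sep_diff S (entries w' true) (entries w' false)| < d%:C%C) ->
      matched e (entries w' true) (entries w' false).
  elim: s => [|w s [Ss [d [d0 IH]]]]; first by exists [::], 1.
  have [S [d' [_ d'0 h]]] := hnb w.
  exists (S :: Ss), (Num.min d d'); split; first by rewrite lt_min d0.
  move=> v w'; rewrite inE => /predU1P[-> nw'|vs nw'] hS.
    apply: h => //; rewrite (lt_le_trans (hS S (mem_head _ _)))//.
    by rewrite lecR ge_min lexx orbT.
  apply: IH vs nw' _ => T hT.
  by rewrite (lt_le_trans (hS T _)) ?inE ?hT ?orbT// lecR ge_min lexx.
(* The filter of finite lists of centres, directed by inclusion. Near-covering compactness along it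
   yields one list [D] whose neighbourhoods cover the whole box. *)
pose Fl : set_system (seq W) := fun Q =>
  exists s0 : seq W, forall s : seq W, {subset s0 <= s} -> Q s.
have FlF : Filter Fl.
  split; first by exists [::].
    move=> P Q [s hs] [t ht]; exists (s ++ t) => r hr.
    by split; [apply: hs|apply: ht] => v hv;
      apply: hr; rewrite mem_cat hv ?orbT.
  by move=> P Q PQ [s hs]; exists s => t /hs/PQ.
have [|D /(_ D (fun _ => id)) cov] := (compact_near_coveringP _).1
    (@tychonoff _ (fun _ : bool * 'I_n * 'I_m => C) (fun=> K0) (fun=> cK0))
    _ Fl (fun s w' => exists2 w, w \in s & nb w w') FlF.
  move=> w _; exists (nb w, [set s : seq W | w \in s]).
    split; first by have [S [d []]] := hnb w.
    by exists [:: w] => s; apply; exact: mem_head.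
  by move=> [w' s] [/= nw' ws]; exists w.
have [Ss [d [d0 h]]] := hfin D.
exists Ss, d; split=> // l u lM uM hlu.
pose w : W := fun k => (if k.1.1 then l else u) k.1.2 k.2.
have wE b : entries w b = if b then l else u.
  by apply/matrixP => i j; rewrite mxE /w /=; case: b.
have [[[b i] j]|v vD nbv] := cov w; first by apply: hK0; rewrite /w/=; case: b.
have := h v w vD nbv; rewrite !wE; exact.
Qed.

End Matching.

Lemma matching_intertwiner (C : numClosedFieldType) n m (A B : 'I_m -> 'M[C]_n)
    (P Q : 'M[C]_n) (l u : 'M[C]_(n, m)) (s : {perm 'I_n}) (e : C) :
    0 <= e -> P \is unitarymx -> Q \is unitarymx ->
    (forall j, A j = P ^t* *m diag_mx (col j l)^T *m P) ->
    (forall j, B j = Q ^t* *m diag_mx (col j u)^T *m Q) ->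
    (forall i j, `|l i j - u (s i) j| <= e) ->
  exists2 V : 'M[C]_n, V \is unitarymx &
    forall j, mxbound (n%:R ^+ 2 * e) (V ^t* *m A j *m V - B j).
Proof.
move=> e0 hP hQ hA hB hs; pose S : 'M[C]_n := perm_mx s.
have SE : S ^t* = perm_mx s^-1 by rewrite /S tr_perm_mx map_perm_mx.
have hS : S \is unitarymx.
  by apply/unitarymxP; rewrite SE -perm_mxM mulgV perm_mx1.
(* The unitary carries the eigenbasis of the [B j] to that of the [A j], permuted by the matching; a
   diagonal error of size [e] remains, conjugated by [Q]. *)
exists (P ^t* *m S *m Q); first by rewrite !mul_unitarymx// unitarymx_inv.
move=> j; rewrite hA hB.
have -> : (P ^t* *m S *m Q) ^t* *m (P ^t* *m diag_mx (col j l)^T *m P) *m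
      (P ^t* *m S *m Q) - Q ^t* *m diag_mx (col j u)^T *m Q =
    Q ^t* *m (S ^t* *m diag_mx (col j l)^T *m S - diag_mx (col j u)^T) *m Q.
  rewrite !trmx_mul !map_mxM trmxCK mulmxBr mulmxBl !mulmxA.
  congr (_ - _).
  rewrite -(mulmxA _ P (P ^t*)) (unitarymxP hP) mulmx1.
  by rewrite -(mulmxA _ P (P ^t*)) (unitarymxP hP) mulmx1.
apply: mxbound_conj => //; first exact: unitarymx_inv.
move=> i k; rewrite SE -row_permE.
have -> : S = perm_mx (s^-1)^-1%g by rewrite invgK.
rewrite -col_permE.
rewrite !mxE (inj_eq perm_inj); case: eqP => [_|]; last first.
  by rewrite !mulr0n subrr normr0.
by rewrite !mulr1n; have := hs ((s^-1)%g i) j; rewrite permKV.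
Qed.

(** * Matrix representations of C(X) *)

Section Representation.
Context {R : realType} {X : topologicalType} {n : nat}.
Local Notation C := R[i].

(** A predicate on plain functions, so that the evaluation of a homomorphism at a point of the
    interval qualifies directly. *)
Definition matrix_rep (e : cfun R X -> 'M[C]_n) := [/\ e 1 = 1%:M,
  forall f g, e (f + g) = e f + e g, forall f g, e (f * g) = e f *m e g,
  forall k f, e (k *: f) = k *: e f & forall f, e (cfun_star f) = (e f) ^t*].

Lemma matrix_rep_eval (T : topologicalType) (phi : unital_star_hom R X T n) t :
  matrix_rep (fun f => phi f t).
Proof.
split.
- by rewrite rmorph1.
- by move=> f g; rewrite rmorphD.
- by move=> f g; rewrite rmorphM.
- by move=> k f; rewrite star_homZ.
- by move=> f; rewrite star_homV.
Qed.

Context (e : cfun R X -> 'M[C]_n) (he : matrix_rep e).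

Lemma matrix_rep_comm f g : comm_mx (e f) (e g).
Proof. by have [_ _ eM _ _] := he; rewrite /comm_mx -!eM mulrC. Qed.

Lemma matrix_rep_diag m (f : 'I_m -> cfun R X) :
  exists P (l : 'M[C]_(n, m)), P \is unitarymx /\
    forall j, e (f j) = P ^t* *m diag_mx (col j l)^T *m P.
Proof.
have [_ _ _ _ eS] := he.
apply: (joint_unitary_diag (A := fun j => e (f j))) => j k.
  exact: matrix_rep_comm.
by rewrite -eS; exact: matrix_rep_comm.
Qed.

(** If [f] omitted the value [d_i], then [f - d_i] would be invertible in C(X), and so would its
    image; but in the eigenbasis that image is diagonal with a zero at (i, i). *)
Lemma eigenvalue_in_range (P : 'M[C]_n) (d : 'rV[C]_n) (f : cfun R X) i :
    P \is unitarymx -> e f = P ^t* *m diag_mx d *m P ->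
  exists x, f x = d 0 i.
Proof.
move=> hP ef; apply: contrapT => /forallNP fd.
have fd0 x : f x - d 0 i != 0 by rewrite subr_eq0; apply/eqP; exact: fd.
have cfd : continuous (fun x => f x - d 0 i).
  by apply: continuousC_add; [exact: cts_fun|exact: cst_continuous].
pose g : cfun R X := mkcts (continuousC_inv fd0 cfd).
have fg1 : (f + (- d 0 i) *: (1 : cfun R X)) * g = 1.
  apply/continuousEP => x.
  change ((f x + - d 0 i * 1) * (f x - d 0 i)^-1 = 1).
  by rewrite mulr1 divff.
have [e1 eD eM eZ _] := he.
have := congr1 e fg1; rewrite eM eD eZ e1 => h.
have {h} :
    P *m (e f + (- d 0 i) *: 1%:M) *m P ^t* *m (P *m e g *m P ^t*) = 1%:M.
  by rewrite !mulmxA -(mulmxA _ _ P) unitarymx_adj// mulmx1 -(mulmxA P) h mulmx1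
    (unitarymxP hP).
have -> : P *m (e f + (- d 0 i) *: 1%:M) *m P ^t* = diag_mx d - (d 0 i)%:M.
  rewrite mulmxDr mulmxDl ef !mulmxA (unitarymxP hP) mul1mx -mulmxA.
  rewrite (unitarymxP hP) mulmx1; congr (_ + _).
  by rewrite -scalemxAr -scalemxAl mulmx1 (unitarymxP hP) scaleNr scalemx1.
move=> /matrixP/(_ i i); rewrite [RHS]mxE eqxx mulr1n mxE big1.
  by move/eqP; rewrite eq_sym oner_eq0.
move=> k _; rewrite !mxE; have [->|] := eqVneq i k; first by rewrite subrr mul0r.
by rewrite !mulr0n subrr mul0r.
Qed.

Definition abs_sq_shift (f : cfun R X) (z : C) : cfun R X :=
  let g := f + (- z) *: (1 : cfun R X) in g * cfun_star g.

Definition sep_fun m (f : 'I_m -> cfun R X) (S : seq 'rV[C]_m) : cfun R X :=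
  \prod_(q <- S) \sum_j abs_sq_shift (f j) (q 0 j).

(** The map [D] from vectors to matrices diagonal in the common eigenbasis respects sums, products,
    scalars and adjoints, so [e] carries the polynomial [sep_fun] to its values at the joint
    eigenvalues. *)
Lemma matrix_rep_trace_sep m (f : 'I_m -> cfun R X) (P : 'M[C]_n)
    (l : 'M[C]_(n, m)) S : P \is unitarymx ->
    (forall j, e (f j) = P ^t* *m diag_mx (col j l)^T *m P) ->
  \tr (e (sep_fun f S)) = \sum_i sep_value S (row i l).
Proof.
move=> hP hf; have [e1 eD eM eZ eS] := he.
pose D (v : 'I_n -> C) := P ^t* *m diag_mx (\row_i v i) *m P.
have D1 : D (fun=> 1) = 1%:M.
  rewrite /D (_ : \row_i _ = const_mx 1) ?diag_const_mx ?mulmx1 ?unitarymx_adj//.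
  by apply/rowP => i; rewrite !mxE.
have DD v w : D v + D w = D (fun i => v i + w i).
  rewrite /D -mulmxDl -mulmxDr -raddfD; congr (_ *m diag_mx _ *m _).
  by apply/rowP => i; rewrite !mxE.
have DM v w : D v *m D w = D (fun i => v i * w i).
  rewrite /D !mulmxA -(mulmxA _ P (P ^t*)) (unitarymxP hP) mulmx1.
  rewrite -(mulmxA (P ^t*)) mulmx_diag; congr (_ *m diag_mx _ *m _).
  by apply/rowP => i; rewrite !mxE.
have DZ k v : k *: D v = D (fun i => k * v i).
  rewrite /D scalemxAl scalemxAr -linearZ; congr (_ *m diag_mx _ *m _).
  by apply/rowP => i; rewrite !mxE.
have DS v : (D v) ^t* = D (fun i => (v i)^*).
  rewrite /D !trmx_mul !map_mxM trmxCK tr_diag_mx map_diag_mx mulmxA.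
  by congr (_ *m diag_mx _ *m _); apply/rowP => i; rewrite !mxE.
have e0 : e 0 = D (fun=> 0).
  rewrite -(scale0r (1 : cfun R X)) eZ e1 -D1 DZ; congr D.
  by apply/funext => i; rewrite mul0r.
have Df j : e (f j) = D (fun i => l i j).
  rewrite hf (_ : (col j l)^T = \row_i l i j)//.
  by apply/rowP => i; rewrite !mxE.
have -> : e (sep_fun f S) = D (fun i => sep_value S (row i l)).
  rewrite /sep_fun /sep_value; elim: S => [|q S IH].
    by rewrite big_nil e1 -D1; congr D; apply/funext => i; rewrite big_nil.
  rewrite big_cons eM IH.
  pose v j i := (l i j - q 0 j) * (l i j - q 0 j)^*.
  have Dj j : e (abs_sq_shift (f j) (q 0 j)) = D (v j).
    rewrite /abs_sq_shift eM eS eD eZ e1 Df -D1 DZ DD DS DM; congr D.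
    apply/funext => i.
    by rewrite mulr1.
  have Dsum (r : seq 'I_m) : e (\sum_(j <- r) abs_sq_shift (f j) (q 0 j)) =
      D (fun i => \sum_(j <- r) v j i).
    elim: r => [|j r IHr].
      by rewrite big_nil e0; congr D; apply/funext => i; rewrite big_nil.
    rewrite big_cons eD Dj IHr DD; congr D; apply/funext => i.
    by rewrite big_cons.
  rewrite Dsum DM; congr D; apply/funext => i; rewrite big_cons; congr (_ * _).
  by apply: eq_bigr => j _; rewrite mxE.
rewrite /D mxtrace_mulC mulmxA (unitarymxP hP) mul1mx mxtrace_diag.
by apply: eq_bigr => i _; rewrite mxE.
Qed.

End Representation.

(** * Compactness, norms and traces *)

Section CompactCW.
Context {R : realType}.

Lemma continuous_sq_enorm d : continuous (@sq_enorm R d).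
Proof.
have cj j : continuous (fun v : 'rV[R]_d => v 0 j ^+ 2).
  move=> v.
  apply: (@continuous_comp _ _ _ (fun v : 'rV[R]_d => v 0 j)
    (fun x : R => x ^+ 2)).
    exact: coord_continuous.
  exact: exprn_continuous.
rewrite /sq_enorm => v; elim: (index_enum _) => [|j s IH].
  under eq_fun do rewrite big_nil; exact: cst_continuous.
under eq_fun do rewrite big_cons.
exact: (@cvgD _ R^o 'rV[R]_d (nbhs v) _ (fun v : 'rV[R]_d => v 0 j ^+ 2)
  _ _ _ (cj j v) IH).
Qed.

Lemma compact_closed_disc d : compact (closed_disc R d).
Proof.
have box : compact
    [set v : 'rV[R]_d | forall i, `[(-1 : R), 1]%classic (v ord0 i)].
  apply: (@rV_compact _ _ (fun=> `[(-1 : R), 1]%classic)) => _.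
  exact: segment_compact.
apply: subclosed_compact box _.
  apply: (@closed_comp _ R (@sq_enorm R d) [set x | x <= 1]).
    by move=> v _; exact: continuous_sq_enorm.
  exact: (@closed_le R).
move=> v hv i; rewrite /= in_itv/= -ler_norml -(@expr_le1 _ 2)//.
rewrite real_normK ?num_real//.
apply: le_trans hv; rewrite /sq_enorm (bigD1 i)//= lerDl.
by apply: sumr_ge0 => k _; exact: sqr_ge0.
Qed.

(** The open cells cover [X], so [X] is a finite union of continuous images of compact discs. *)
Lemma compact_finite_cw (X : topologicalType) :
  finite_cw_complex R X -> compact [set: X].
Proof.
move=> [_ [cw]].
have -> : [set: X] = \big[setU/set0]_(c : cell R X cw)
    (cell_map R X cw c @` closed_disc R (cell_dim R X cw c)).
  apply/seteqP; split => // x _.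
  have [c [[v hv vx] _]] := cell_partition R X cw x.
  rewrite (bigD1 c)//=; left; exists v => //.
  by move: hv; rewrite /open_disc /closed_disc /= => /ltW.
apply: bigsetU_compact => c _; apply: continuous_compact.
  exact: cell_map_continuous.
exact: compact_closed_disc.
Qed.

Lemma cfun_bounded (X : topologicalType) (f : cfun R X) : compact [set: X] ->
  exists M : R, forall x, `|f x| <= M%:C%C.
Proof.
have nR (a : R) : (`|a|)%:C%C = `|a%:C%C| :> R[i].
  by rewrite normc_def/= expr0n addr0 sqrtr_sqr.
have distC (z w : R[i]) : `| `|z| - `|w| | <= `|z - w|.
  have wr : `|z| - `|w| \is Num.real by rewrite rpredB ?normr_real.
  by rewrite real_ler_norml// lerB_dist andbT lerNl opprB distrC lerB_dist.
move=> cX; have cn : continuous (fun x => ComplexField.Normc.normc (f x) : R).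
  move=> x; apply/(@cvgrPdist_lt _ R^o X (nbhs x)) => e e0.
  have eC : 0 < e%:C%C :> R[i] by rewrite ltcR.
  have /(@cvgrPdist_lt _ (R[i]^o) X (nbhs x) _)/(_ _ eC) := @cts_fun _ _ f x.
  apply: filterS => y; rewrite -ltcR nR rmorphB; apply: le_lt_trans.
  exact: distC.
have /compact_bounded [M [_ hM]] :
    compact ((fun x => ComplexField.Normc.normc (f x) : R^o) @` [set: X]).
  by apply: continuous_compact => //; exact: continuous_subspaceT.
exists (M + 1) => x; have := hM (M + 1); rewrite ltrDl ltr01 => /(_ isT).
move=> /(_ (ComplexField.Normc.normc (f x))) h.
have : `|ComplexField.Normc.normc (f x)| <= M + 1 by apply: h; exists x.
by move=> /(le_trans (ler_norm _)); rewrite -lecR.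
Qed.

End CompactCW.

Section OperatorNorm.
Context {R : realType} {n : nat}.
Local Notation C := R[i].

Lemma complex_normc_ge0 (z : C) : 0 <= ComplexField.Normc.normc z.
Proof. by rewrite -ler0c; exact: (normr_ge0 z). Qed.

Lemma cvnorm_entry_le1 (v : 'cV[C]_n) i : cvnorm v <= 1 -> `|v i 0| <= 1.
Proof.
rewrite /cvnorm => hv.
have S1 : \sum_i ComplexField.Normc.normc (v i 0) ^+ 2 <= 1.
  by rewrite -(@ler_sqrt _ _ 1)// sqrtr1.
rewrite -[1]/(1%:C%C : C) lecR -(@expr_le1 _ 2)//; last first.
  exact: complex_normc_ge0.
apply: le_trans S1; rewrite (bigD1 i)//= lerDl.
by apply: sumr_ge0 => k _; exact: sqr_ge0.
Qed.

(** A vector in the unit ball has entries of modulus at most 1, so each entry of its image is at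
    most [n * c]; the Euclidean norm costs a further sqrt(n), bounded by [n]. *)
Lemma mx_opnorm_le (c : R) (A : 'M[C]_n) : 0 <= c -> mxbound c%:C%C A ->
  mx_opnorm A <= n%:R ^+ 2 * c.
Proof.
move=> c0 hA; apply: ge_sup.
  exists (cvnorm (A *m 0)); exists 0 => //=.
  rewrite /cvnorm big1 ?sqrtr0// => i _.
  by rewrite mxE ComplexField.Normc.normc0 expr0n.
move=> _ [v /= hv <-].
have h i : ComplexField.Normc.normc ((A *m v) i 0) <= n%:R * c.
  rewrite -lecR rmorphM/= rmorph_nat -[c%:C%C]mulr1.
  apply: (mxboundM hA) => k j; rewrite ord1; exact: cvnorm_entry_le1.
have hn : 0 <= n%:R ^+ 2 * c by rewrite mulr_ge0 ?exprn_ge0.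
rewrite /cvnorm -[leRHS]ger0_norm// -sqrtr_sqr ler_sqrt ?sqr_ge0//.
rewrite (@le_trans _ _ (\sum_(i < n) (n%:R * c) ^+ 2))//.
  apply: ler_sum => i _; rewrite ler_pXn2r// ?nnegrE ?mulr_ge0//.
  exact: complex_normc_ge0.
rewrite sumr_const card_ord -[X in X <= _]mulr_natl.
have -> : (n%:R ^+ 2 * c) ^+ 2 = n%:R ^+ 2 * (n%:R * c) ^+ 2 by ring.
rewrite ler_wpM2r ?sqr_ge0// -natrX ler_nat.
by case: n => // k; rewrite expnS leq_pmulr// expn_gt0.
Qed.

Lemma cmxfun_norm_le (T : topologicalType) (t0 : T) (a : cmxfun R T n) (c : R) :
  0 <= c -> (forall t, mxbound c%:C%C (a t)) -> cmxfun_norm a <= n%:R ^+ 2 * c.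
Proof.
move=> c0 ha; apply: ge_sup; first by exists (mx_opnorm (a t0)), t0.
by move=> _ [t _ <-]; exact: mx_opnorm_le.
Qed.

End OperatorNorm.

Section NormalizedTrace.
Context {R : realType} {T : topologicalType} {n : nat}.
Variable t : T.

(** These point traces are the tracial states to which the closeness hypothesis is applied. *)
Definition trace_at (a : cmxfun R T n) : R[i] := n%:R^-1 * \tr (a t).

Lemma trace_at_scalar : scalar trace_at.
Proof.
move=> k a b; rewrite /trace_at.
change (n%:R^-1 * \tr (k *: a t + b t) =
  k * (n%:R^-1 * \tr (a t)) + n%:R^-1 * \tr (b t)).
by rewrite mxtraceD mxtraceZ; ring.
Qed.

HB.instance Definition _ := GRing.isLinear.Build R[i] (cmxfun R T n) R[i]
  *%R trace_at trace_at_scalar.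

Lemma trace_at_tracial : (0 < n)%N -> tracial_state trace_at.
Proof.
move=> n0; split.
- change (n%:R^-1 * \tr (1%:M : 'M[R[i]]_n) = 1).
  by rewrite mxtrace1 mulVf// pnatr_eq0 -lt0n.
- move=> a; change (0 <= n%:R^-1 * \tr ((a t) ^t* *m a t)).
  rewrite mulr_ge0 ?invr_ge0//; apply: sumr_ge0 => i _; rewrite mxE.
  by apply: sumr_ge0 => k _; rewrite !mxE mulrC -normCK exprn_ge0.
- move=> a b; change (n%:R^-1 * \tr (a t *m b t) = n%:R^-1 * \tr (b t *m a t)).
  by rewrite mxtrace_mulC.
Qed.

End NormalizedTrace.

Section Interval.
Context {R : realType}.

Let clamp_mem (x : R) : clamp x \in `[0, 1]%classic.
Proof. by rewrite inE /= in_itv /= clamp_itv. Qed.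

(** Clamping retracts the line onto the interval, so paths can be handled as functions of a real
    variable. *)
Definition to_unit_interval (x : R) : unit_interval R := SigSub (clamp_mem x).

Lemma continuous_to_unit_interval : continuous to_unit_interval.
Proof.
apply: continuous_comp_initial; exact: continuous_clamp.
Qed.

Lemma unit_interval_itv (t : unit_interval R) : 0 <= val t <= 1.
Proof. by have := valP t; rewrite inE /= in_itv. Qed.

Lemma to_unit_intervalK (t : unit_interval R) : to_unit_interval (val t) = t.
Proof. by apply: val_inj; apply: clamp_id; exact: unit_interval_itv. Qed.

Lemma continuous_val_unit_interval :
  continuous (val : unit_interval R -> R).
Proof. exact: initial_continuous. Qed.

(** Uniform continuity on a compact interval, with one mesh for all entries of all functions in the
    list. *)
Lemma uniform_mesh n (s : seq (cmxfun R (unit_interval R) n)) (e : R[i]) :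
    0 < e ->
  exists N : nat, forall x y : R, 0 <= x <= 1 -> 0 <= y <= 1 ->
    `|x - y| <= N.+1%:R^-1 -> forall a, a \in s ->
    mxbound e (a (to_unit_interval x) - a (to_unit_interval y)).
Proof.
move=> e0.
have e2 : 0 < e / 2 by rewrite divr_gt0.
pose h (a : cmxfun R (unit_interval R) n) i j x : R[i] :=
  a (to_unit_interval x) i j.
have ch a i j : continuous (h a i j).
  move=> x; apply: (@continuous_comp R _ _ to_unit_interval (fun t => a t i j)).
    exact: continuous_to_unit_interval.
  exact: cmxfun_entry.
have near_s x : \forall y \near x, forall a, a \in s -> forall i j,
    `|h a i j x - h a i j y| < e / 2.
  elim: s => [|a s IH].
    by apply: (@filterE R (nbhs x) (nbhs_filter x)) => y a; rewrite inE.
  have ha : \forall y \near x, forall i j, `|h a i j x - h a i j y| < e / 2.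
    apply: (@filter_forall R _
      (fun i y => forall j, `|h a i j x - h a i j y| < e / 2) (nbhs x)
      (nbhs_filter x)) => i.
    apply: (@filter_forall R _ (fun j y => `|h a i j x - h a i j y| < e / 2)
      (nbhs x) (nbhs_filter x)) => j.
    by have /(@cvgrPdist_lt _ (R[i]^o) R (nbhs x) _) := ch a i j x; apply.
  apply: filterS2 ha IH => y ha IH b; rewrite inE => /predU1P[-> //|].
  exact: IH.
pose P (N : nat) (x : R) := forall y, `|x - y| <= N.+1%:R^-1 ->
  forall a, a \in s -> forall i j, `|h a i j x - h a i j y| <= e.
have [x _|N hN] := @filter_ex _ \oo _ _
    ((compact_near_coveringP _).1 (@segment_compact R 0 1) nat \oo P _ _).
  have /nbhs_ballP[r /= r0 hr] := near_s x.
  have r2 : 0 < r / 2 by rewrite divr_gt0.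
  (* Half of the radius goes to the centre moving from [x] to [x'], half to the mesh width, so that
     [y] stays within [r] of [x]. *)
  exists (ball x (r / 2), [set N : nat | N.+1%:R^-1 < r / 2]).
    split; first exact: nbhsx_ballx.
    exact: (near_infty_natSinv_lt (PosNum r2)).
  move=> [x' N] [/= bx' hN] y x'y a sa i j.
  have bx'r : ball x r x'.
    move: bx'; rewrite /ball/= => /lt_trans; apply.
    by rewrite ltr_pdivrMr// ltr_pMr// ltr1n.
  have byr : ball x r y.
    rewrite /ball/=; have -> : x - y = (x - x') + (x' - y) by ring.
    rewrite (le_lt_trans (ler_normD _ _))// [r]splitr ltr_leD//.
    exact: le_trans x'y (ltW hN).
  have -> : h a i j x' - h a i j y =
    (h a i j x - h a i j y) - (h a i j x - h a i j x') by ring.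
  rewrite (le_trans (ler_normB _ _))// [e]splitr lerD// ltW//.
    exact: hr byr a sa i j.
  exact: hr bx'r a sa i j.
exists N => x y x01 _ xy a sa i j; rewrite !mxE.
by apply: hN => //; rewrite /= in_itv.
Qed.

End Interval.

(** * Approximate unitary equivalence *)

Section Assembly.
Context {R : realType} {X : topologicalType} {n : nat}.
Local Notation C := R[i].
Local Notation A := (cmxfun R (unit_interval R) n).

(** The joint eigenvalues are values of the [f j], hence bounded independently of the homomorphisms
    and of [t]. This lets the tests and [d] be chosen beforehand. *)
Lemma pointwise_intertwiner m (f : 'I_m -> cfun R X) (c : R) :
    compact [set: X] -> (0 < n)%N -> 0 < c ->
  exists (Ss : seq (seq 'rV[C]_m)) (d : R), 0 < d /\
  forall phi psi : unital_star_hom R X (unit_interval R) n,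
    (forall S, S \in Ss -> forall tau : {scalar A}, tracial_state tau ->
       ComplexField.Normc.normc
         (tau (phi (sep_fun f S)) - tau (psi (sep_fun f S))) < d) ->
  forall t, exists2 V : 'M[C]_n, V \is unitarymx &
    forall j, mxbound c%:C%C (V ^t* *m phi (f j) t *m V - psi (f j) t).
Proof.
move=> cX n0 c0.
have [M hM] : exists M : R, forall j x, `|f j x| <= M%:C%C.
  have [Mj hMj] := choice (fun j => cfun_bounded (f j) cX).
  exists (\sum_j `|Mj j|) => j x; rewrite (le_trans (hMj j x))// lecR.
  rewrite (bigD1 j)//= (le_trans (ler_norm _))// lerDl.
  by apply: sumr_ge0 => k _; exact: normr_ge0.
pose e : R := c / (n%:R ^+ 2 + 1).
have n21 : 0 < n%:R ^+ 2 + 1 :> R by rewrite ltr_wpDl// exprn_ge0.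
have e0 : 0 < e by rewrite divr_gt0.
have eC0 : 0 < e%:C%C :> C by rewrite ltcR.
have [Ss [d [d0 hd]]] := @eigenvalue_matching R n m M _ eC0.
have nR0 : 0 < n%:R :> R by rewrite ltr0n.
(* The tracial states are normalized, while the matching lemma compares unnormalized traces. *)
exists Ss, (d / n%:R); split; first by rewrite divr_gt0.
move=> phi psi htr t.
have rphi := matrix_rep_eval phi t; have rpsi := matrix_rep_eval psi t.
have [P [l [hP hl]]] := matrix_rep_diag rphi f.
have [Q [u [hQ hu]]] := matrix_rep_diag rpsi f.
have bound (r : cfun R X -> 'M[C]_n) (W : 'M[C]_n) (v : 'M[C]_(n, m)) :
    matrix_rep r -> W \is unitarymx ->
    (forall j, r (f j) = W ^t* *m diag_mx (col j v)^T *m W) -> mxbound M%:C%C v.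
  move=> hr hW hv i j.
  have [x fx] := eigenvalue_in_range hr i hW (hv j).
  by have := hM j x; rewrite fx !mxE.
have [s hs] : exists s : {perm 'I_n}, forall i j, `|l i j - u (s i) j| <= e%:C%C.
  apply: hd; [exact: bound rphi hP hl|exact: bound rpsi hQ hu|].
  move=> S hS; rewrite -(matrix_rep_trace_sep rphi S hP hl).
  rewrite -(matrix_rep_trace_sep rpsi S hQ hu).
  have := htr S hS _ (trace_at_tracial t n0).
  set x := \tr _; set y := \tr _.
  change (ComplexField.Normc.normc (n%:R^-1 * x - n%:R^-1 * y) < d / n%:R ->
    `|x - y| < d%:C%C).
  rewrite -mulrBr -ltcR => hxy.
  have : `|n%:R^-1 * (x - y)| < (d / n%:R)%:C%C by exact: hxy.
  rewrite normrM normfV normr_nat rmorphM/= fmorphV/= rmorph_nat mulrC.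
  by rewrite ltr_pM2r// invr_gt0 ltr0n.
have [V hV hVb] := matching_intertwiner (ltW eC0) hP hQ hl hu hs.
exists V => // j i k; rewrite (le_trans (hVb j i k))//.
rewrite -(rmorph_nat (real_complex R)) -rmorphXn -rmorphM lecR /e.
by rewrite mulrCA ler_piMr ?(ltW c0)// ler_pdivrMr// mul1r lerDl.
Qed.

Lemma unitary_from_pointwise (eps : R) : 0 < eps ->
  exists2 c : R, 0 < c & forall m (a b : 'I_m -> A) (V : R -> 'M[C]_n),
    (forall x, V x \is unitarymx) ->
    (forall x, 0 <= x <= 1 -> forall j, mxbound c%:C%C
       ((V x) ^t* *m a j (to_unit_interval x) *m V x -
        b j (to_unit_interval x))) ->
  exists U : A, [/\ unitary U, U zero = V 0, U one = V 1 &
    forall j, cmxfun_norm (ad U (a j) - b j) < eps].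
Proof.
move=> eps0; have [K K0 hK] := @unitary_patching R n.
have KE : K = (complex.Re K)%:C%C by rewrite RRe_real// ger0_real.
move: (complex.Re K) KE => k KE; rewrite KE ler0c in K0.
have k0 : 0 < n%:R ^+ 2 * k + 1 :> R.
  by rewrite ltr_wpDl// mulr_ge0// exprn_ge0.
(* Patching multiplies the error by [k] and the operator norm by [n ^ 2]; the added 1 makes the
   final inequality strict and the denominator positive. *)
exists (eps / (n%:R ^+ 2 * k + 1)); first by rewrite divr_gt0.
set c := eps / _ => m a b V hV hab.
have c0 : 0 < c by rewrite divr_gt0.
have cC0 : 0 < c%:C%C :> C by rewrite ltcR.
have [N hN] := uniform_mesh (codom a ++ codom b) cC0.
have [|U [cU hU U0 U1 hUb]] := hK 'I_m (fun j x => a j (to_unit_interval x))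
    (fun j x => b j (to_unit_interval x)) c%:C%C V N hV hab.
  move=> x y x01 y01 xy j.
  by split; apply: hN => //; rewrite mem_cat codom_f ?orbT.
have cUv : continuous (fun t : unit_interval R => U (val t)).
  move=> t; apply: (@continuous_comp _ _ _ (val : unit_interval R -> R) U).
    exact: continuous_val_unit_interval.
  exact: cU.
exists (mkcts cUv); split => //.
- split; apply/continuousEP => t.
    exact: (unitarymx_adj (hU (val t))).
  exact: (unitarymxP (hU (val t))).
move=> j; have kc0 : 0 <= k * c by rewrite mulr_ge0// ltW.
apply: (@le_lt_trans _ _ (n%:R ^+ 2 * (k * c))).
  apply: (cmxfun_norm_le zero) => // t.
  have := hUb _ (unit_interval_itv t) j.
  by rewrite to_unit_intervalK KE -rmorphM.
rewrite mulrA /c mulrCA gtr_pMr// ltr_pdivrMr// mul1r.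
by rewrite ltrDl ltr01.
Qed.

End Assembly.

Theorem lemma4p1 (R : realType) (X : topologicalType) (n : nat)
    (X_cw : finite_cw_complex R X) (X_pc : path_connected R X)
    (n_ge1 : (1 <= n)%N)
    (eps : R) (eps_gt0 : 0 < eps)
    (F : set (cfun R X)) (F_fin : finite_set F) :
  exists (G : set (cfun R X)) (delta : R),
    [/\ finite_set G, 0 < delta &
    forall phi psi : unital_star_hom R X (unit_interval R) n,
      (forall g, G g ->
       forall tau : {scalar (cmxfun R (unit_interval R) n)}, tracial_state tau ->
         ComplexField.Normc.normc (tau (phi g) - tau (psi g)) < delta) ->
      [/\ exists U : cmxfun R (unit_interval R) n,
            unitary U /\
            (forall f, F f -> cmxfun_norm (ad U (phi f) - psi f) < eps),
          (forall f : cfun R X, phi f zero = psi f zero) ->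
          exists U : cmxfun R (unit_interval R) n,
            [/\ unitary U, U zero = 1%:M &
                forall f, F f -> cmxfun_norm (ad U (phi f) - psi f) < eps] &
          (forall f : cfun R X,
             phi f zero = psi f zero /\ phi f one = psi f one) ->
          exists U : cmxfun R (unit_interval R) n,
            [/\ unitary U, U zero = 1%:M, U one = 1%:M &
                forall f, F f -> cmxfun_norm (ad U (phi f) - psi f) < eps]]].
Proof.
have /finite_seqP[s Fs] := F_fin.
pose f (j : 'I_(size s)) : cfun R X := tnth (in_tuple s) j.
have Ff g : F g -> exists j, g = f j.
  by rewrite Fs /= => gs; have /tnthP[j gj] : g \in in_tuple s by []; exists j.
have [c c0 hc] := @unitary_from_pointwise R n _ eps_gt0.
have cX := compact_finite_cw X_cw.
have [Ss [d [d0 hd]]] := pointwise_intertwiner f cX n_ge1 c0.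
exists [set` [seq sep_fun f T | T <- Ss]], d; split=> //.
move=> phi psi htr.
have pointwise t : exists W : 'M[R[i]]_n, W \is unitarymx /\
    forall j, mxbound c%:C%C (W ^t* *m phi (f j) t *m W - psi (f j) t).
  have [|W hW hWb] := hd phi psi _ t; last by exists W.
  by move=> S hS; apply: htr; rewrite /= map_f.
have [V hV] := choice pointwise.
(* [B] marks points where the homomorphisms agree; there the pointwise unitary is replaced by 1,
   which intertwines exactly. The three claims take [B] empty, {0} and {0, 1}. *)
have key (B : pred R) : (forall x, B x -> forall g,
      phi g (to_unit_interval x) = psi g (to_unit_interval x)) ->
    exists U : cmxfun R (unit_interval R) n,
      [/\ unitary U, B 0 -> U zero = 1%:M, B 1 -> U one = 1%:M &
          forall g, F g -> cmxfun_norm (ad U (phi g) - psi g) < eps].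
  move=> hB; pose W x := if B x then 1%:M else V (to_unit_interval x).
  have [x|x x01 j|U [hU U0 U1 hUf]] :=
      hc _ (fun j => phi (f j)) (fun j => psi (f j)) W.
  - rewrite /W; case: ifP => _; first exact: unitarymx1.
    by have [] := hV (to_unit_interval x).
  - rewrite /W; case: ifPn => [Bx|_]; last by have [_] := hV (to_unit_interval x).
    move=> i k; rewrite hB// trmx1 map_mx1 mul1mx mulmx1 subrr mxE normr0.
    by rewrite ler0c ltW.
  exists U; split=> //.
  - by rewrite U0 /W => ->.
  - by rewrite U1 /W => ->.
  by move=> g /Ff[j ->].
have z0 : to_unit_interval 0 = zero :> unit_interval R.
  by apply: val_inj; apply: clamp_id; rewrite lexx ler01.
have z1 : to_unit_interval 1 = one :> unit_interval R.
  by apply: val_inj; apply: clamp_id; rewrite lexx ler01.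
split.
- by have [//|U [hU _ _ hUF]] := key pred0; exists U.
- move=> h0; have [x /eqP -> g|U [hU U0 _ hUF]] := key (pred1 0).
    by rewrite z0.
  by exists U; split=> //; apply: U0; rewrite /= eqxx.
- move=> h01; have [x /= /orP[] /eqP -> g|U [hU U0 U1 hUF]] := key (pred2 0 1).
  + by rewrite z0; have [] := h01 g.
  + by rewrite z1; have [] := h01 g.
  by exists U; split=> //; [apply: U0|apply: U1]; rewrite /= eqxx ?orbT.
Qed.
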